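(* Let $\mathcal{N}$ be an open subset of a Fréchet space $E$, let $L\in C^\infty(\mathcal{N}\times E,\mathbb{R})$ be a Lagrangian, and let $\mathsf{E}_L(g,k):=D_2L(g,k)(k)-L(g,k)$ be its energy. Then along every critical curve $c\colon I\to\mathcal{N}$ of $L$ ($I\subset\mathbb{R}$ an open interval), the function $t\mapsto\mathsf{E}_L(c(t),c'(t))$ is constant.
   Context: Smoothness is in the convenient sense: a map between open subsets of Fréchet spaces is smooth if it sends smooth curves to smooth curves. $D_2L(g,k)\in E'$ denotes the partial differential of $L$ in the second argument. A variation with compact support of $c\in C^\infty(I,\mathcal{N})$ is a smooth map $c_\bullet\colon\mathbb{R}\times I\to\mathcal{N}$, $(s,t)\mapsto c_s(t)$, with $c_0=c$ and such that there is a compact $K\subset I$ with $c_s(t)=c(t)$ for all $s$ and all $t\notin K$. A smooth curve $c$ is critical for $L$ if for every variation with compact support $c_\bullet$ of $c$, and some (equivalently, any) relatively compact open $J\subset I$ containing $K$, $\frac{d}{ds}\big|_{s=0}\int_J L(c_s(t),c_s'(t))\,dt=0$, where $c_s'=\partial_tc_s$. *)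

(* Defs.v *)
From HB Require Import structures.
From mathcomp Require Import all_boot all_order all_algebra.
From mathcomp Require Import all_classical all_reals all_analysis.

Set Implicit Arguments.
Unset Strict Implicit.
Unset Printing Implicit Defensive.

Import Order.TTheory GRing.Theory Num.Theory.
Import numFieldNormedType.Exports.

Local Open Scope classical_set_scope.
Local Open Scope ring_scope.

(* A Frechet space is a locally convex space whose topology is induced by a
   complete translation-invariant metric.  The uniform structure carried by a
   [tvsType] is only required to be compatible with the topology, so the
   completeness predicate of the library would not be the right one here. *)
Definition frechet_space (R : realType) (E : tvsType R) : Prop :=
  exists d : E -> E -> R,
    [/\ (forall x y, (d x y = 0) <-> (x = y)),
        (forall x y, d x y = d y x),
        (forall x y z, d x z <= d x y + d y z),
        (forall x y z, d (x + z) (y + z) = d x y) &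
        (forall x (A : set E),
           nbhs x A <-> exists2 e : R, 0 < e & [set y | d x y < e] `<=` A)
        /\
        (forall u : nat -> E,
           (forall e : R, 0 < e ->
              exists n0, forall m n, (n0 <= m)%N -> (n0 <= n)%N ->
                d (u m) (u n) < e) ->
           exists l : E, u @ \oo --> l)].

(* [derivable] and [derive1] are only available for functions with values in a
   normed module, and [lim] only in a pointed type, which a [tvsType] is not. *)
Definition curve_quotient (R : realType) (E : tvsType R) (c : R -> E) (t h : R)
  : E := h^-1 *: (c (h + t) - c t).

Definition curve_derivable (R : realType) (E : tvsType R) (c : R -> E) (t : R)
  : Prop := exists l : E, curve_quotient c t h @[h --> 0^'] --> l.

Definition curve_derive (R : realType) (E : tvsType R) (c : R -> E) (t : R)
  : E := xget 0 [set l : E | curve_quotient c t h @[h --> 0^'] --> l].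

Definition smooth_curve (R : realType) (E : tvsType R) (c : R -> E) : Prop :=
  forall (n : nat) (t : R), curve_derivable (iter n (@curve_derive R E) c) t.

(* [f] is in C^oo(U, V) for U and V open, in the convenient sense; the values
   of [f] outside [U] are irrelevant. *)
Definition smooth_map (R : realType) (E F : tvsType R) (U : set E) (V : set F)
    (f : E -> F) : Prop :=
  (forall x, U x -> V (f x)) /\
  (forall c : R -> E, smooth_curve c -> (forall t, U (c t)) ->
     smooth_curve (f \o c)).

Definition partial2 (R : realType) (E : tvsType R) (L : E * E -> R) (g k v : E)
  : R := derive1 (fun s : R => L (g, k + s *: v)) 0.

Definition energy (R : realType) (E : tvsType R) (L : E * E -> R) (g k : E)
  : R := partial2 L g k k - L (g, k).

(* [v (s, t)] is c_s(t). *)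
Definition compact_variation (R : realType) (E : tvsType R) (N : set E)
    (I : set R) (c : R -> E) (K : set R) (v : R * R -> E) : Prop :=
  [/\ smooth_map ([set: R] `*` I) N v,
      (forall t, I t -> v (0, t) = c t),
      compact K, K `<=` I &
      forall s t, I t -> ~ K t -> v (s, t) = c t].

Definition action (R : realType) (E : tvsType R) (L : E * E -> R) (J : set R)
    (c : R -> E) : R :=
  Rintegral (@lebesgue_measure R) J (fun t => L (c t, curve_derive c t)).

(* Relative compactness of [J] is meant in [I], not merely in the line: the
   integrand need not be integrable up to the boundary of [I]. *)
Definition critical (R : realType) (E : tvsType R) (N : set E) (L : E * E -> R)
    (I : set R) (c : R -> E) : Prop :=
  forall (K : set R) (v : R * R -> E), compact_variation N I c K v ->
    exists J : set R,
      [/\ open J, compact (closure J), closure J `<=` I, K `<=` J &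
          is_derive (0 : R) (1 : R)
            (fun s : R => action L J (fun t => v (s, t))) 0].

(* Main.v *)
Require Import Defs.
From HB Require Import structures.
From mathcomp Require Import all_boot all_order all_algebra.
From mathcomp Require Import all_classical all_reals all_analysis.
From mathcomp Require Import ring lra.

(* Only the variations c (t + s phi t) obtained by reparametrizing c matter: their
   action depends on f x y = L (c x, (1 + y) c' x), and the energy at time x is
   e x = D x - f x 0, with D x the derivative of f x at y = 0.  If e p > e q for
   nearby p and q, take phi rising from 0 to 1 near p and falling back near q; the
   action then grows at rate at least int e phi' > 0, against criticality.

   Since f is only known to be smooth along smooth curves of the plane, the
   quadratic error terms are controlled by a Boman type argument: were the second
   y-derivative of f unbounded near a point, a smooth curve through rapidly
   converging points with rapidly growing second derivatives would give a
   contradiction. *)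

Import Order.TTheory GRing.Theory Num.Theory.
Import numFieldNormedType.Exports.

Local Open Scope classical_set_scope.
Local Open Scope ring_scope.

Set Implicit Arguments.
Unset Strict Implicit.
Unset Printing Implicit Defensive.

(** With [g x = f x 0], the Lagrangian at time [t] changes to first order in [s] by [s (g' phi + D
    phi') = s ((g phi)' + e phi')]. The exact term [(g phi)'] integrates to zero because [phi]
    vanishes at both ends, which is why the energy is what remains. Criticality says that the
    derivative of the action at [s = 0] exists and is zero, but gives no formula for it.
    Differentiating under the integral sign would require joint regularity of the Lagrangian,
    whereas smoothness is only given along curves. So the action is bounded below pointwise, by a
    linear term in [s] minus a quadratic one. A one-sided bound is enough, since [p] and [q] can be
    exchanged. Reparametrizations move the curve along itself, so the estimates concern a scalar
    function of two real variables and never leave the plane. *)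

(** * Differential calculus of curves in a topological vector space *)

Section CurveDerivative.
Context {R : realType}.
Implicit Types (E F : tvsType R) (t : R).

(** A relation, so that the rules of calculus can be proved without the default value of
    [curve_derive]; in a Hausdorff space the two agree wherever a derivative exists. *)
Definition has_curve_derive E (u : R -> E) t (l : E) : Prop :=
  curve_quotient u t h @[h --> 0^'] --> l.

(* Caratheodory's form of differentiability. *)
Lemma has_curve_deriveP E (u : R -> E) t (l : E) :
  has_curve_derive u t l <->
  exists q : R -> E,
    [/\ forall y, u y = u t + (y - t) *: q y, q t = l & q @ t --> l].
Proof.
split=> [ul|[q [uq qt ql]]].
  pose q y := if y == t then l else (y - t)^-1 *: (u y - u t).
  have qt : q t = l by rewrite /q eqxx.
  exists q; split=> // [y|].
    rewrite /q; case: eqVneq => [->|yt]; first by rewrite subrr scale0r addr0.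
    by rewrite scalerA mulfV ?subr_eq0// scale1r addrC subrK.
  move=> A Al; have /= := ul A Al; rewrite /nbhs/= => -[e /= e0 He].
  exists e => //= y; rewrite /ball/= => ye.
  rewrite /q; case: eqVneq => [_|yt]; first exact: nbhs_singleton.
  have := He (y - t); rewrite /ball/= sub0r normrN distrC in ye *.
  by rewrite /curve_quotient subrK; apply; rewrite ?subr_eq0.
move=> A /ql /= [e /= e0 He]; exists e => //= h; rewrite /ball/= sub0r normrN.
move=> he h0; rewrite /curve_quotient uq addrC addKr addrK scalerA mulVf//.
by rewrite scale1r; apply: He; rewrite /= opprD addrCA subrr addr0 normrN.
Qed.

Lemma cvg2_add E (p q : R -> E) (F : set_system R) {FF : Filter F} (l m : E) :
  p @ F --> l -> q @ F --> m -> p x + q x @[x --> F] --> l + m.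
Proof.
move=> pl qm; apply: (cvg_comp (fun x => (p x, q x)) (fun z : E * E => z.1 + z.2)).
  exact: cvg_pair pl qm.
exact: (@add_continuous E (l, m)).
Qed.

Lemma cvg2_scale E (p : R -> R^o) (q : R -> E) (F : set_system R)
    {FF : Filter F} (l : R^o) (m : E) :
  p @ F --> l -> q @ F --> m -> p x *: q x @[x --> F] --> l *: m.
Proof.
move=> pl qm.
apply: (cvg_comp (fun x => (p x, q x)) (fun z : R^o * E => z.1 *: z.2)).
  exact: cvg_pair pl qm.
exact: (@scale_continuous R E (l, m)).
Qed.

Lemma has_curve_derive_continuous E (u : R -> E) t (l : E) :
  has_curve_derive u t l -> {for t, continuous u}.
Proof.
move=> /has_curve_deriveP[q [uq qt ql]].
rewrite /prop_for /continuous_at.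
have qc : (y - t) *: q y @[y --> t] --> (t - t : R^o) *: l.
  apply: cvg2_scale ql.
  by apply: cvgB; [exact: cvg_id|exact: cvg_cst].
have : u t + (y - t) *: q y @[y --> t] --> u t + (t - t : R^o) *: l.
  by apply: cvg2_add => //; exact: cvg_cst.
rewrite subrr scale0r addr0 (_ : (fun y => _) = u)//.
by apply/funext => y; rewrite -uq.
Qed.

Lemma has_curve_derive_uniq E (u : R -> E) t (l l' : E) : hausdorff_space E ->
  has_curve_derive u t l -> has_curve_derive u t l' -> l = l'.
Proof. by move=> hE; apply: cvg_unique. Qed.

Lemma has_curve_derive_near E (u v : R -> E) t (l : E) :
  (\forall y \near t, u y = v y) ->
  has_curve_derive u t l -> has_curve_derive v t l.
Proof.
move=> uv; apply: cvg_trans; apply: near_eq_cvg.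
have uvt := nbhs_singleton uv.
case: uv => e /= e0 He; exists e => //= h; rewrite /ball/= sub0r normrN => he _.
rewrite /curve_quotient uvt (He (h + t))// /ball/=.
by rewrite opprD addrCA subrr addr0 normrN.
Qed.

Lemma has_curve_derive_cst E (a : E) t : has_curve_derive (fun=> a) t 0.
Proof.
apply/has_curve_deriveP; exists (fun=> 0); split=> // [y|].
  by rewrite scaler0 addr0.
exact: cvg_cst.
Qed.

Lemma has_curve_derive_id t : has_curve_derive (id : R -> R) t 1.
Proof.
apply/has_curve_deriveP; exists (fun=> 1); split=> // [y|].
  by rewrite /GRing.scale/= mulr1 addrC subrK.
exact: cvg_cst.
Qed.

Lemma has_curve_deriveD E (u v : R -> E) t (l m : E) :
  has_curve_derive u t l -> has_curve_derive v t m ->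
  has_curve_derive (fun y => u y + v y) t (l + m).
Proof.
move=> /has_curve_deriveP[p [up pt pl]] /has_curve_deriveP[q [vq qt qm]].
apply/has_curve_deriveP; exists (fun y => p y + q y); split=> [y||].
- by rewrite up vq scalerDr addrACA.
- by rewrite pt qt.
- exact: cvg2_add.
Qed.

Lemma has_curve_deriveZ E (a : R -> R) (u : R -> E) t (b : R) (l : E) :
  has_curve_derive a t b -> has_curve_derive u t l ->
  has_curve_derive (fun y => a y *: u y) t (b *: u t + a t *: l).
Proof.
move=> /has_curve_deriveP[p [ap pt pb]] ul.
have cu := has_curve_derive_continuous ul.
move: ul => /has_curve_deriveP[q [uq qt ql]].
apply/has_curve_deriveP.
exists (fun y => p y *: u y + a t *: q y); split=> [y||].
- rewrite [in LHS]ap scalerDl [in X in X + _ = _]uq scalerDr -addrA.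
  by rewrite scalerDr !scalerA (mulrC (a t)) (addrC (_ *: q y)).
- by rewrite pt qt.
- by apply: cvg2_add; apply: cvg2_scale => //; exact: cvg_cst.
Qed.

Lemma has_curve_derive_comp E (u : R -> E) (x : R -> R) t (b : R) (l : E) :
  has_curve_derive x t b -> has_curve_derive u (x t) l ->
  has_curve_derive (u \o x) t (b *: l).
Proof.
move=> xb; have cx := has_curve_derive_continuous xb.
move: xb => /has_curve_deriveP[p [xp pt pb]] /has_curve_deriveP[q [uq qt ql]].
apply/has_curve_deriveP; exists (fun y => p y *: q (x y)); split=> [y||].
- have xpE : x y - x t = (y - t) * p y by rewrite (xp y) addrC addKr.
  by rewrite /= uq xpE scalerA.
- by rewrite pt qt.
- by apply: cvg2_scale => //; exact: cvg_comp cx ql.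
Qed.

Lemma has_curve_derive_pair E F (u : R -> E) (v : R -> F) t (l : E) (m : F) :
  has_curve_derive u t l -> has_curve_derive v t m ->
  has_curve_derive (fun y => (u y, v y) : E * F) t (l, m).
Proof. by move=> ul vm; apply: cvg_pair. Qed.

Lemma has_curve_derive_fst E F (w : R -> E * F) t (l : E * F) :
  has_curve_derive w t l -> has_curve_derive (fst \o w) t l.1.
Proof. by move=> wl; apply: (cvg_comp _ fst wl); exact: cvg_fst. Qed.

Lemma has_curve_derive_snd E F (w : R -> E * F) t (l : E * F) :
  has_curve_derive w t l -> has_curve_derive (snd \o w) t l.2.
Proof. by move=> wl; apply: (cvg_comp _ snd wl); exact: cvg_snd. Qed.

Lemma hausdorff_prod E F : hausdorff_space E -> hausdorff_space F ->
  hausdorff_space (E * F)%type.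
Proof.
move=> hE hF [x y] [x' y'] xy; congr pair.
- apply: hE => A B Ax Bx'.
  have [||[z w] [[/= Az _] [Bz _]]] := xy (A `*` setT) (B `*` setT).
  + by exists (A, setT) => //; split=> //; exact: filterT.
  + by exists (B, setT) => //; split=> //; exact: filterT.
  + by exists z.
- apply: hF => A B Ay By'.
  have [||[z w] [[/= _ Aw] [_ Bw]]] := xy (setT `*` A) (setT `*` B).
  + by exists (setT, A) => //; split=> //; exact: filterT.
  + by exists (setT, B) => //; split=> //; exact: filterT.
  + by exists w.
Qed.

(** Balls of radius half the distance of two distinct points are disjoint. This is what makes
    derivatives unique. *)
Lemma frechet_hausdorff E : frechet_space E -> hausdorff_space E.
Proof.
move=> [d [d0 ds dt _ [dn _]]] x y xy; apply/d0.
have d_ge0 z w : 0 <= d z w.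
  have := dt z w z; rewrite (ds w z) (d0 z z).2//; lra.
apply/eqP; rewrite eq_le d_ge0 andbT leNgt; apply/negP => dxy.
have dxy2 : 0 < d x y / 2 by lra.
have [||z [/= xz yz]] := xy [set z | d x z < d x y / 2] [set z | d y z < d x y / 2].
- by apply/dn; exists (d x y / 2).
- by apply/dn; exists (d x y / 2).
- by have := dt x z y; rewrite (ds z y); lra.
Qed.

(** The derivative is a witness instead of a computed function, and the order is finite: closure
    under sums, products and composition then follows by induction on [n]. *)
Fixpoint n_differentiable E (n : nat) (u : R -> E) : Prop :=
  if n is n'.+1 then
    exists2 u' : R -> E, (forall t, has_curve_derive u t (u' t)) &
      n_differentiable n' u'
  else True.

Lemma smooth_curveP E (u : R -> E) : hausdorff_space E ->
  smooth_curve u <-> forall n, n_differentiable n u.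
Proof.
move=> hE.
have derE (v : R -> E) t l : has_curve_derive v t l -> curve_derive v t = l.
  by move=> vl; apply: (has_curve_derive_uniq hE _ vl); apply: (xgetPex 0); exists l.
split=> [+ n|].
  elim: n u => // n IH u su; exists (curve_derive u) => [t|].
    by apply: (xgetPex 0); exact: (su 0%N t).
  by apply: IH => k t; have := su k.+1 t; rewrite iterSr.
move=> + n; elim: n u => [|n IH] u nu t.
  by have [u' uu' _] := nu 1%N; exists (u' t); exact: uu'.
rewrite iterSr; apply: IH => k; have [u' uu' nu'] := nu k.+1.
by rewrite (_ : curve_derive u = u')//; apply/funext => s; exact: derE.
Qed.

Lemma n_differentiableS E n (u : R -> E) :
  n_differentiable n.+1 u -> n_differentiable n u.
Proof.
elim: n u => // n IH u [u' uu' nu']; exists u' => //; exact: IH.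
Qed.

Lemma n_differentiable_cst E n (a : E) : n_differentiable n (fun=> a : E).
Proof.
by elim: n a => // n IH a; exists (fun=> 0) => // t; exact: has_curve_derive_cst.
Qed.

Lemma n_differentiable_id n : n_differentiable n (id : R -> R).
Proof.
case: n => // n; exists (fun=> 1); first by move=> t; exact: has_curve_derive_id.
exact: (@n_differentiable_cst R).
Qed.

Lemma n_differentiableD E n (u v : R -> E) :
  n_differentiable n u -> n_differentiable n v ->
  n_differentiable n (fun y => u y + v y).
Proof.
elim: n u v => // n IH u v [u' uu' nu'] [v' vv' nv'].
by exists (fun y => u' y + v' y); [move=> t; exact: has_curve_deriveD|exact: IH].
Qed.

Lemma n_differentiableZ E n (a : R -> R) (u : R -> E) :
  n_differentiable n a -> n_differentiable n u ->
  n_differentiable n (fun y => a y *: u y).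
Proof.
elim: n a u => // n IH a u na nu.
have na_ := n_differentiableS na; have nu_ := n_differentiableS nu.
move: na nu => [a' aa' na'] [u' uu' nu'].
exists (fun y => a' y *: u y + a y *: u' y).
  by move=> t; exact: has_curve_deriveZ.
by apply: n_differentiableD; apply: IH.
Qed.

Lemma n_differentiable_comp E n (x : R -> R) (u : R -> E) :
  n_differentiable n x -> n_differentiable n u -> n_differentiable n (u \o x).
Proof.
elim: n x u => // n IH x u nx [u' uu' nu'].
have nx_ := n_differentiableS nx; case: nx => x' xx' nx'.
exists (fun y => x' y *: u' (x y)).
  by move=> t; exact: has_curve_derive_comp.
by apply: n_differentiableZ => //; exact: (IH x u').
Qed.

Lemma n_differentiable_pair E F n (u : R -> E) (v : R -> F) :
  n_differentiable n u -> n_differentiable n v ->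
  n_differentiable n (fun y => (u y, v y) : E * F).
Proof.
elim: n u v => // n IH u v [u' uu' nu'] [v' vv' nv'].
exists (fun y => (u' y, v' y)); last exact: IH.
by move=> t; exact: has_curve_derive_pair.
Qed.

Lemma n_differentiable_fst E F n (w : R -> E * F) :
  n_differentiable n w -> n_differentiable n (fst \o w).
Proof.
elim: n w => // n IH w [w' ww' nw']; exists (fst \o w'); last exact: IH.
by move=> t; exact: has_curve_derive_fst.
Qed.

Lemma n_differentiable_snd E F n (w : R -> E * F) :
  n_differentiable n w -> n_differentiable n (snd \o w).
Proof.
elim: n w => // n IH w [w' ww' nw']; exists (snd \o w'); last exact: IH.
by move=> t; exact: has_curve_derive_snd.
Qed.

Lemma has_curve_derive_is_derive (u : R -> R) t (l : R) :
  has_curve_derive u t l <-> is_derive t 1 u l.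
Proof.
have E : (fun h => h^-1 *: ((u \o shift t) (h *: 1) - u t)) = curve_quotient u t.
  by apply/funext => h; rewrite /curve_quotient /= /GRing.scale/= mulr1.
split=> [ul|[du <-]].
  by apply: DeriveDef; [rewrite /derivable E; apply/cvg_ex; exists l|
    rewrite /derive E; exact: cvg_lim].
by rewrite /derive /has_curve_derive E; rewrite /derivable E in du.
Qed.

End CurveDerivative.

(** * Smooth functions flat at the origin: steps, bumps and clamps *)

Section FlatFunctions.
Context {R : realType}.
Implicit Types (u v w b : R -> R) (t r z : R).

(** Each order may come with its own witness for the derivative; uniqueness merges them into one
    function. *)
Lemma n_differentiable_derive (E : tvsType R) (u : R -> E) :
  hausdorff_space E -> (forall n, n_differentiable n u) ->
  exists2 u' : R -> E, (forall t, has_curve_derive u t (u' t)) &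
    forall n, n_differentiable n u'.
Proof.
move=> hE nu; have [u' uu' _] := nu 1%N; exists u' => // n.
have [u2 uu2 nu2] := nu n.+1; rewrite (_ : u' = u2)//; apply/funext => t.
exact: (has_curve_derive_uniq hE (uu' t) (uu2 t)).
Qed.

Definition smooth_real u : Prop := forall n, n_differentiable n u.

Lemma smooth_real_derive u : smooth_real u ->
  exists2 u' : R -> R, (forall t, has_curve_derive u t (u' t)) & smooth_real u'.
Proof. by move=> su; apply: n_differentiable_derive => //; exact: norm_hausdorff. Qed.

Lemma smooth_real_continuous u : smooth_real u -> continuous u.
Proof. by move=> /(_ 1%N)[u' uu' _] t; exact: has_curve_derive_continuous (uu' t). Qed.

Lemma smooth_real_cst (a : R) : smooth_real (fun=> a).
Proof. by move=> n; exact: (@n_differentiable_cst R R). Qed.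

Lemma smooth_real_id : smooth_real (fun t => t).
Proof. by move=> n; exact: n_differentiable_id. Qed.

Lemma smooth_realD u v : smooth_real u -> smooth_real v ->
  smooth_real (fun t => u t + v t).
Proof. by move=> su sv n; exact: (@n_differentiableD R R). Qed.

Lemma smooth_realM u v : smooth_real u -> smooth_real v ->
  smooth_real (fun t => u t * v t).
Proof. by move=> su sv n; exact: (@n_differentiableZ R R). Qed.

Lemma smooth_real_comp u v : smooth_real v -> smooth_real u ->
  smooth_real (fun t => u (v t)).
Proof. by move=> sv su n; exact: (@n_differentiable_comp R R n v u). Qed.

Lemma smooth_realN u : smooth_real u -> smooth_real (fun t => - u t).
Proof.
move=> su; rewrite (_ : (fun t => _) = fun t => -1 * u t).
  exact: smooth_realM (smooth_real_cst _) su.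
by apply/funext => t; rewrite mulN1r.
Qed.

Lemma smooth_realB u v : smooth_real u -> smooth_real v ->
  smooth_real (fun t => u t - v t).
Proof. by move=> su sv; apply: smooth_realD => //; exact: smooth_realN. Qed.

Lemma smooth_realV u : (forall t, u t != 0) -> smooth_real u ->
  smooth_real (fun t => (u t)^-1).
Proof.
move=> u0 su n; elim: n => // n IH.
have [u' uu' su'] := smooth_real_derive su.
exists (fun t => - u' t * ((u t)^-1 * (u t)^-1)).
  move=> t; apply/has_curve_derive_is_derive.
  have /has_curve_derive_is_derive uu := uu' t.
  have := is_deriveV (u0 t) uu; congr is_derive.
  by rewrite /GRing.scale/= mulNr mulNr mulrC -exprVn expr2.
apply: (@n_differentiableZ R R); first exact: smooth_realN.
exact: (@n_differentiableZ R R).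
Qed.

(** The power [k] makes the family stable under differentiation: the derivative of [r^-k w(1/r)] is
    a combination of the same expressions with [(k + 1, w)] and [(k + 2, w')]. *)
Definition flat (k : nat) w r : R := if 0 < r then r^-1 ^+ k * w r^-1 else 0.

Lemma flat_has_derive (k : nat) w w' t (C : R) :
  (forall z, 0 < z -> is_derive z 1 w (w' z)) ->
  (forall z, 0 < z -> z ^+ k.+2 * `|w z| <= C) ->
  has_curve_derive (flat k w) t
    (- k%:R * flat k.+1 w t + - 1 * flat k.+2 w' t).
Proof.
move=> ww' wC; have [t0|t0|->] := ltgtP t 0.
- rewrite {2 3}/flat ltNge (ltW t0)/= !mulr0 addr0.
  apply: has_curve_derive_near (has_curve_derive_cst (0 : R) t).
  near=> y; rewrite /flat ltNge ifF//; apply/negbF/ltW.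
  by near: y; exact: lt_nbhsl.
- rewrite {2 3}/flat t0.
  apply: (@has_curve_derive_near _ _ (fun r => r^-1 ^+ k * w r^-1)).
    by near=> y; rewrite /flat ifT//; near: y; exact: lt_nbhsr.
  apply/has_curve_derive_is_derive.
  have tV : is_derive t 1 (fun r => r^-1) (- t ^- 2 *: 1).
    by apply: is_deriveV; rewrite gt_eqF.
  have wt : is_derive t 1 (w \o (fun r => r^-1)) (w' t^-1 * (- t ^- 2 *: 1)).
    by apply: is_derive1_comp; apply: ww'; rewrite invr_gt0.
  have -> : (fun r => r^-1 ^+ k * w r^-1) =
      (fun r => r^-1) ^+ k * (w \o (fun r => r^-1)).
    by rewrite mulrfctE exprfctE.
  apply: is_derive_eq.
  rewrite /GRing.scale/= exprfctE mulr1.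
  have -> : t ^- 2 = t^-1 ^+ 2 by rewrite exprVn.
  case: k {wC} => [|k]; first by rewrite expr0 mulr0n; ring.
  by rewrite /= -mulr_natl !exprS; ring.
- rewrite {2 3}/flat ltxx !mulr0 addr0.
  (* Of the [k + 2] powers of decay, [k + 1] absorb the negative powers of [y] in this quotient, and
     the last one leaves the bound [|y| * C]. At [y = 0] the convention [0^-1 = 0] already gives the
     value of the derivative. *)
  apply/has_curve_deriveP; exists (fun y => y^-1 * flat k w y); split.
  + move=> y; rewrite {2}/flat ltxx add0r subr0 /GRing.scale/=.
    have [->|y0] := eqVneq y 0; first by rewrite /flat ltxx mul0r.
    by rewrite mulrA mulfV// mul1r.
  + by rewrite invr0 mul0r.
  + have C0 : 0 <= C.
      by apply: le_trans (wC 1 ltr01); rewrite expr1n mul1r.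
    apply: norm_cvg0.
    apply: (@squeeze_cvgr _ _ _ _ (fun=> 0) (fun y => `|y| * C)).
    * near=> y; rewrite normr_ge0/= /flat; case: ifPn => y0; last first.
        by rewrite mulr0 normr0 mulr_ge0.
      have Vy0 : 0 < y^-1 by rewrite invr_gt0.
      have := wC _ Vy0; rewrite !normrM normrX (gtr0_norm Vy0) (gtr0_norm y0).
      rewrite -(ler_pM2l y0); apply: le_trans.
      by rewrite exprS -mulrA (mulrA y) mulfV ?gt_eqF// mul1r exprS -mulrA.
    * exact: cvg_cst.
    * have : `|y| * C @[y --> (0 : R)] --> `|0 : R| * C.
        by apply: cvgM; [exact: norm_continuous|exact: cvg_cst].
      by rewrite normr0 mul0r.
Unshelve. all: by end_near. Qed.

(* Functions [w] on the half-line all of whose derivatives decay faster than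
   any power at infinity: in the variable [1 / r] they become smooth and flat
   at the origin. *)
Lemma flat_smooth (W : set (R -> R)) :
  (forall w, W w -> exists2 w', W w' & forall z, 0 < z -> is_derive z 1 w (w' z)) ->
  (forall k w, W w -> exists C, forall z, 0 < z -> z ^+ k * `|w z| <= C) ->
  forall k w, W w -> smooth_real (flat k w).
Proof.
move=> hW bW k w Ww n; elim: n k w Ww => // n IH k w Ww.
have [w' Ww' ww'] := hW _ Ww; have [C wC] := bW k.+2 _ Ww.
exists (fun t => - k%:R * flat k.+1 w t + - 1 * flat k.+2 w' t).
  by move=> t; exact: flat_has_derive ww' wC.
by apply: (@n_differentiableD R R); apply: (@n_differentiableZ R R);
  [exact: smooth_real_cst|exact: IH|exact: smooth_real_cst|exact: IH].
Qed.

(** Raise [z / k <= expR (z / k)] to the power [k]. *)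
Lemma powr_le_expR (k : nat) z : 0 <= z -> z ^+ k <= k%:R ^+ k * expR z.
Proof.
move=> z0; case: k => [|k]; first by rewrite !expr0 mul1r -expR0 ler_expR.
have k0 : 0 < k.+1%:R :> R by rewrite ltr0n.
rewrite -{1}(mulfVK (lt0r_neq0 k0) z) mulrC exprMn ler_pM2l ?exprn_gt0//.
rewrite -[leRHS](_ : expR (z / k.+1%:R) ^+ k.+1 = _); last first.
  by rewrite -expRM_natl mulrC mulfVK// lt0r_neq0.
apply: lerXn2r; rewrite ?nnegrE ?expR_ge0 ?divr_ge0//.
by apply: le_trans (expR_ge1Dx _); rewrite lerDr.
Qed.

Lemma flat_exp_smooth : smooth_real (flat 0 (fun z => expR (- z))).
Proof.
apply: (@flat_smooth [set w | exists c, w = fun z => c * expR (- z)]).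
- move=> _ [c ->]; exists (fun z => - c * expR (- z)); first by exists (- c).
  move=> z z0; have := is_derive1_comp (is_derive_expR (- z))
    (is_deriveNid z 1) => /(is_deriveZ c).
  by congr is_derive; rewrite /GRing.scale/=; ring.
- move=> k _ [c ->]; exists (k%:R ^+ k * `|c|) => z z0.
  rewrite normrM mulrCA mulrC (gtr0_norm (expR_gt0 _)).
  rewrite ler_wpM2r// expRN ler_pdivrMr ?expR_gt0//.
  exact: powr_le_expR (ltW z0).
- by exists 1; apply/funext => z; rewrite mul1r.
Qed.

Lemma exists_smooth_step : exists S : R -> R,
  [/\ smooth_real S, forall x, x <= 0 -> S x = 0, forall x, 1 <= x -> S x = 1,
      forall x, 0 <= S x <= 1 & {homo S : x y / x <= y}].
Proof.
pose g := flat 0 (fun z => expR (- z)).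
have gE x : g x = if 0 < x then expR (- x^-1) else 0.
  by rewrite /g /flat expr0 mul1r.
have g0 x : 0 <= g x by rewrite gE; case: ifP => // _; exact: expR_ge0.
have gp x : 0 < x -> 0 < g x by move=> x0; rewrite gE x0 expR_gt0.
have gn x : x <= 0 -> g x = 0 by rewrite gE leNgt => /negbTE ->.
have gm : {homo g : x y / x <= y}.
  move=> x y xy; have [x0|x0] := ltP 0 x; last by rewrite (gn x)//.
  rewrite !gE x0 (lt_le_trans x0 xy) ler_expR lerN2 lef_pV2//.
  by rewrite posrE (lt_le_trans x0 xy).
have dp x : 0 < g x + g (1 - x).
  have [x0|x0] := ltP 0 x; first by rewrite ltr_pwDl// gp.
  by rewrite ltr_wpDl// gp// subr_gt0 (le_lt_trans x0).
exists (fun x => g x * (g x + g (1 - x))^-1); split.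
- have sg : smooth_real g by exact: flat_exp_smooth.
  apply: smooth_realM => //; apply: smooth_realV.
    by move=> t; rewrite gt_eqF.
  apply: smooth_realD => //; apply: smooth_real_comp sg.
  exact: smooth_realB (smooth_real_cst 1) smooth_real_id.
- by move=> x x0; rewrite gn// mul0r.
- move=> x x1; rewrite (gn (1 - x)) ?subr_le0// addr0 mulfV// gt_eqF// gp//.
  exact: lt_le_trans x1.
- move=> x; by rewrite divr_ge0 ?(ltW (dp x))//= ler_pdivrMr// mul1r lerDl.
- move=> x y xy; rewrite ler_pdivrMr// mulrAC ler_pdivlMr//.
  rewrite !mulrDr; have := gm _ _ xy.
  have : g (1 - y) <= g (1 - x) by apply: gm; rewrite lerB.
  have := g0 x; have := g0 y; have := g0 (1 - x); have := g0 (1 - y); nra.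
Qed.

Lemma exists_smooth_bump : exists B : R -> R,
  [/\ smooth_real B, forall x, `|x| <= 1 -> B x = 1,
      forall x, 2 <= `|x| -> B x = 0 & forall x, 0 <= B x <= 1].
Proof.
have [S [sS S0 S1 S01 _]] := exists_smooth_step.
exists (fun x => S (2 + x) * S (2 - x)); split.
- apply: smooth_realM; apply: smooth_real_comp sS.
    exact: smooth_realD (smooth_real_cst 2) smooth_real_id.
  exact: smooth_realB (smooth_real_cst 2) smooth_real_id.
- by move=> x; rewrite ler_norml => /andP[x1 x2]; rewrite !S1 ?mulr1; lra.
- move=> x; rewrite ler_normr => /orP[x2|x2].
    by rewrite (S0 (2 - x)) ?mulr0; lra.
  by rewrite (S0 (2 + x)) ?mul0r; lra.
- move=> x; have /andP[a0 a1] := S01 (2 + x); have /andP[b0 b1] := S01 (2 - x).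
  by rewrite mulr_ge0//= mulr_ile1.
Qed.

(** Composition with a clamp confines a parameter to a small interval without altering it near the
    origin; this keeps curves and variations inside an open set. *)
Lemma exists_smooth_clamp (k : R) : 0 < k -> exists K : R -> R,
  [/\ smooth_real K, forall x, `|x| <= k -> K x = x &
      forall x, `|K x| <= 2 * k].
Proof.
move=> k0; have [B [sB B1 B0 B01]] := exists_smooth_bump.
exists (fun x => x * B (x * k^-1)); split.
- apply: smooth_realM smooth_real_id _; apply: smooth_real_comp sB.
  exact: smooth_realM smooth_real_id (smooth_real_cst _).
- move=> x xk; rewrite B1 ?mulr1// normrM normfV (gtr0_norm k0).
  by rewrite ler_pdivrMr// mul1r.
- move=> x; have /andP[b0 b1] := B01 (x * k^-1).
  have [xk|xk] := leP (2 * k) `|x|.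
    rewrite B0; first by rewrite mulr0 normr0 mulr_ge0// ltW.
    by rewrite normrM normfV (gtr0_norm k0) ler_pdivlMr.
  rewrite normrM (ger0_norm b0); apply: le_trans (ltW xk).
  by rewrite ler_piMr.
Qed.

Lemma homo_has_derive_ge0 u t (l : R) : {homo u : x y / x <= y} ->
  has_curve_derive u t l -> 0 <= l.
Proof.
move=> um ul.
have h : hausdorff_space R by exact: norm_hausdorff.
have lE : lim (curve_quotient u t h @[h --> 0^']) = l by exact: cvg_lim.
rewrite -lE; apply: limr_ge; first by apply/cvg_ex; exists l.
near=> y; rewrite /curve_quotient /GRing.scale/=.
have [y0|y0] := leP 0 y.
  by rewrite mulr_ge0 ?invr_ge0// subr_ge0 um// lerDr.
by rewrite mulr_le0 ?invr_le0 ?(ltW y0)// subr_le0 um// gerDr ltW.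
Unshelve. all: by end_near. Qed.

Lemma smooth_real_bounded_itv u (a b : R) : smooth_real u ->
  exists2 M, 0 <= M & forall t, a <= t <= b -> `|u t| <= M.
Proof.
move=> su; have cu := smooth_real_continuous su.
have [ab|ab] := leP a b; last first.
  by exists 0 => // t /andP[h1 h2]; move: (le_trans h1 h2); rewrite leNgt ab.
have [c _ cM] : exists2 c, c \in `[a, b] &
    forall t, t \in `[a, b] -> `|u t| <= `|u c|.
  apply: (@EVT_max R (fun t => `|u t|)) => //.
  apply: continuous_subspaceT => t.
  by apply: continuous_comp; [exact: cu|exact: norm_continuous].
by exists `|u c|.
Qed.

End FlatFunctions.

(** * Smooth curves through rapidly converging points, and Boman's bound *)

Section CurveThroughPoints.
Context {R : realType}.
Implicit Types (b u w X Y : R -> R) (a : nat -> R) (t r z : R).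

Definition supported_quarter b : Prop := forall t, 1 / 4 < `|t| -> b t = 0.

(* For [0 < z], the truncation is the integer nearest to [z]. *)
Definition glue b a z : R :=
  a (Num.truncn (z + 1 / 2)) * b (z - (Num.truncn (z + 1 / 2))%:R).

(** The nearest integer jumps at half-integers, but there the bumps on both sides vanish, being
    supported within [1 / 4] of their centres. *)
Lemma glue_near b a z : supported_quarter b -> 0 < z ->
  \forall z' \near z, glue b a z' =
    a (Num.truncn (z + 1 / 2)) * b (z' - (Num.truncn (z + 1 / 2))%:R).
Proof.
move=> hb z0; set n := Num.truncn (z + 1 / 2).
have /andP[n1 n2] : n%:R <= z + 1 / 2 < n.+1%:R by apply: truncn_itv; lra.
rewrite -(natr1 n) in n2.
near=> y.
(* If the nearest integers [m] of [y] and [n] of [z] differ, a half-integer separates the two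
   points; with this margin [y] is still farther than [1 / 4] from both [m] and [n]. *)
have yz : `|y - z| < 1 / 8.
  rewrite distrC; near: y; apply: cvgr_dist_lt; [exact: cvg_id|lra].
have y0 : 0 < y by near: y; exact: lt_nbhsr.
rewrite /glue; set m := Num.truncn (y + 1 / 2).
have /andP[m1 m2] : m%:R <= y + 1 / 2 < m.+1%:R by apply: truncn_itv; lra.
rewrite -(natr1 m) in m2; rewrite ltr_norml in yz; case/andP: yz => yz1 yz2.
have [->//|mn] := eqVneq m n.
suff : 1 / 4 < `|y - n%:R| /\ 1 / 4 < `|y - m%:R|.
  by move=> [/hb -> /hb ->]; rewrite !mulr0.
rewrite !ltr_normr; case: (ltngtP m n) mn => // mn _.
- have : m.+1%:R <= n%:R :> R by rewrite ler_nat.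
  by rewrite -(natr1 m) => ?; split; apply/orP; [right|left]; lra.
- have : n.+1%:R <= m%:R :> R by rewrite ler_nat.
  by rewrite -(natr1 n) => ?; split; apply/orP; [left|right]; lra.
Unshelve. all: by end_near. Qed.

Lemma supported_quarter_derive b b' : supported_quarter b ->
  (forall t, has_curve_derive b t (b' t)) -> supported_quarter b'.
Proof.
move=> hb bb' t ht.
apply: (has_curve_derive_uniq _ (bb' t)); first exact: norm_hausdorff.
apply: has_curve_derive_near (has_curve_derive_cst 0 t).
near=> y; rewrite hb//; near: y.
by apply: cvgr_norm_gt ht; exact: cvg_id.
Unshelve. all: by end_near. Qed.

Lemma supported_quarter_bounded b : smooth_real b -> supported_quarter b ->
  exists C, forall t, `|b t| <= C.
Proof.
move=> sb hb; have [C C0 hC] := smooth_real_bounded_itv (-1) 1 sb.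
exists C => t; have [t1|t1] := leP `|t| 1; first by apply: hC; rewrite -ler_norml.
by rewrite hb ?normr0//; lra.
Qed.

(** Differentiation acts on the bump and leaves the coefficients alone, so the functions glued with
    a fixed [a] form a stable class. The exponential decay of [a] then beats every power of [z]. *)
Lemma smooth_flat_glue b a : smooth_real b -> supported_quarter b ->
  (forall n, `|a n| <= expR (- n%:R)) -> smooth_real (flat 0 (glue b a)).
Proof.
move=> sb hb ha.
apply: (@flat_smooth _ [set w | exists b, [/\ smooth_real b,
  supported_quarter b & w = glue b a]]).
- move=> _ [c [sc hc ->]]; have [c' cc' sc'] := smooth_real_derive sc.
  have hc' := supported_quarter_derive hc cc'.
  exists (glue c' a); first by exists c'.
  move=> z z0; apply/has_curve_derive_is_derive.
  set n := Num.truncn (z + 1 / 2).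
  apply: (@has_curve_derive_near _ _ (fun z' => a n * c (z' - n%:R))).
    by have := @glue_near c a z hc z0; apply: filterS => z' ->.
  apply/has_curve_derive_is_derive.
  have /has_curve_derive_is_derive cz := cc' (z - n%:R).
  have zn : is_derive z 1 (fun z' : R => z' - n%:R) 1.
    apply/has_curve_derive_is_derive.
    have := has_curve_deriveD (has_curve_derive_id z)
      (has_curve_derive_cst (- n%:R : R) z).
    by rewrite addr0.
  have := is_deriveZ (a n) (@is_derive1_comp R c (fun z' => z' - n%:R) z _ _ cz zn).
  by congr is_derive; rewrite /glue -/n /GRing.scale/= mulr1.
- move=> k _ [c [sc hc ->]]; have [C hC] := supported_quarter_bounded sc hc.
  have C0 : 0 <= C by exact: le_trans (hC 0).
  exists (k%:R ^+ k * expR 1 * C) => z z0.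
  set n := Num.truncn (z + 1 / 2).
  have /andP[_ n2] : n%:R <= z + 1 / 2 < n.+1%:R by apply: truncn_itv; lra.
  rewrite /glue -/n normrM mulrA; apply: ler_pM => //.
    by rewrite mulr_ge0// exprn_ge0// ltW.
  (* Since [n > z - 1], the coefficient [expR (- n)] is at most [expR (1 - z)]. *)
  apply: (@le_trans _ _ (z ^+ k * (expR 1 * expR (- z)))).
    apply: ler_wpM2l; first by rewrite exprn_ge0// ltW.
    apply: le_trans (ha n) _.
    by rewrite -(natr1 n) in n2; rewrite -expRD ler_expR; lra.
  rewrite mulrCA mulrC ler_wpM2r ?expR_ge0// expRN ler_pdivrMr ?expR_gt0//.
  exact: powr_le_expR (ltW z0).
- by exists b.
Qed.

Lemma flat_glue_near b a (n : nat) : supported_quarter b -> (0 < n)%N ->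
  \forall r \near (n%:R^-1 : R), flat 0 (glue b a) r = a n * b (r^-1 - n%:R).
Proof.
move=> hb n0; have n0' : 0 < n%:R :> R by rewrite ltr0n.
have nn : Num.truncn (n%:R + 1 / 2 : R) = n.
  by apply: truncn_def; rewrite -(natr1 n); apply/andP; split; lra.
have inv : (r : R)^-1 @[r --> (n%:R^-1 : R)] --> (n%:R : R).
  rewrite -[X in _ --> X]invrK; apply: cvgV; last exact: cvg_id.
  by rewrite invr_neq0// gt_eqF.
have gn : \forall z \near (n%:R : R), glue b a z = a n * b (z - n%:R).
  by have := @glue_near b a n%:R hb n0'; rewrite nn.
near=> r.
have r0 : 0 < r by near: r; apply: lt_nbhsr; rewrite invr_gt0.
by rewrite /flat r0 expr0 mul1r; near: r; exact: inv gn.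
Unshelve. all: by end_near. Qed.

(* A form of the special curve lemma of convenient calculus. *)
Lemma exists_smooth_curve_through (x0 : R) (x y : nat -> R) :
  (forall n, `|x n - x0| <= expR (- n%:R)) ->
  (forall n, `|y n| <= expR (- n%:R)) ->
  exists X Y, [/\ smooth_real X, smooth_real Y &
    forall n, (0 < n)%N -> \forall r \near (n%:R^-1 : R),
      X r = x n /\ Y r = y n + expR (- n%:R) * (r^-1 - n%:R)].
Proof.
move=> hx hy; have [B [sB B1 B0 _]] := @exists_smooth_bump R.
(* The factor 8 sends the radii 1 and 2 of [B] to [1 / 8] and [1 / 4]: [b] is supported as required
   and is 1 around the origin, so the prescribed values are attained exactly. *)
pose b t : R := B (t * 8).
have sb : smooth_real b.
  by apply: smooth_real_comp sB; exact: smooth_realM smooth_real_id (smooth_real_cst _).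
have n8 t : `|t * 8| = `|t| * 8 by rewrite normrM (@ger0_norm _ 8).
have hb : supported_quarter b by move=> t ht; rewrite /b B0// n8; lra.
have b1 t : `|t| <= 1 / 8 -> b t = 1 by move=> ht; rewrite /b B1// n8; lra.
(* A bump of slope 1 at the origin: it gives [Y] the speed [expR (- n)] in the variable [1 / r] as
   it passes through the [n]-th point, while [X] stands still there. *)
pose c t : R := t * b t.
have sc : smooth_real c by exact: smooth_realM smooth_real_id sb.
have hc : supported_quarter c by move=> t ht; rewrite /c hb// mulr0.
have he n : `|expR (- n%:R) : R| <= expR (- n%:R).
  by rewrite ger0_norm// expR_ge0.
exists (fun r => x0 + flat 0 (glue b (fun n => x n - x0)) r).
exists (fun r => flat 0 (glue b y) r + flat 0 (glue c (fun n => expR (- n%:R))) r).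
split.
- exact: smooth_realD (smooth_real_cst _) (smooth_flat_glue sb hb hx).
- exact: smooth_realD (smooth_flat_glue sb hb hy) (smooth_flat_glue sc hc he).
move=> n n0; have n0' : 0 < n%:R :> R by rewrite ltr0n.
have inv : (r : R)^-1 @[r --> (n%:R^-1 : R)] --> (n%:R : R).
  rewrite -[X in _ --> X]invrK; apply: cvgV; last exact: cvg_id.
  by rewrite invr_neq0// gt_eqF.
near=> r.
have br : b (r^-1 - n%:R) = 1.
  apply: b1; rewrite distrC; apply: ltW; near: r.
  by apply: cvgr_dist_lt; [exact: inv|lra].
split.
  have -> : flat 0 (glue b (fun n => x n - x0)) r = (x n - x0) * b (r^-1 - n%:R).
    by near: r; exact: flat_glue_near.
  by rewrite br mulr1 addrC subrK.
have -> : flat 0 (glue b y) r = y n * b (r^-1 - n%:R).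
  by near: r; exact: flat_glue_near.
have -> : flat 0 (glue c (fun n => expR (- n%:R))) r =
    expR (- n%:R) * c (r^-1 - n%:R).
  by near: r; exact: flat_glue_near.
by rewrite /c br !mulr1.
Unshelve. all: by end_near. Qed.

Lemma has_curve_deriveV t : t != 0 ->
  has_curve_derive (fun r : R => r^-1) t (- (t^-1 * t^-1)).
Proof.
move=> t0; apply/has_curve_derive_is_derive.
have := @is_deriveV R id t 1 1 t0 (is_derive_id _ _).
by congr is_derive; rewrite /GRing.scale/= mulr1 -exprVn expr2.
Qed.

(* Boman's argument for the second derivative: otherwise a smooth curve through
   points of fast growing second derivative contradicts the smoothness of [f]
   along it. *)
Lemma second_partial_bounded (f f1 f2 : R -> R -> R) (x0 : R) :
  (forall X Y, smooth_real X -> smooth_real Y ->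
    smooth_real (fun r => f (X r) (Y r))) ->
  (forall x y, has_curve_derive (f x) y (f1 x y)) ->
  (forall x y, has_curve_derive (f1 x) y (f2 x y)) ->
  exists d M : R, 0 < d /\
    forall x y, `|x - x0| <= d -> `|y| <= d -> `|f2 x y| <= M.
Proof.
move=> hf hf1 hf2; apply: contrapT => hn.
(* The curve below meets the [n]-th point with speed [expR (- n)], so the second derivative along it
   carries a factor [expR (- n) ^ 2]. The lower bound is chosen to leave [n] after this loss. *)
have {hn} /choice[p hp] : forall n : nat, exists p : R * R,
    [/\ `|p.1 - x0| <= expR (- n%:R), `|p.2| <= expR (- n%:R) &
        n%:R * expR n%:R * expR n%:R < `|f2 p.1 p.2|].
  move=> n; apply: contrapT => h; apply: hn.
  exists (expR (- n%:R)), (n%:R * expR n%:R * expR n%:R).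
  split=> [|x y hx hy]; first exact: expR_gt0.
  by rewrite leNgt; apply/negP => hxy; apply: h; exists (x, y).
have [X [Y [sX sY XY]]] := @exists_smooth_curve_through x0
  (fun n => (p n).1) (fun n => (p n).2)
  (fun n => let: And3 h _ _ := hp n in h) (fun n => let: And3 _ h _ := hp n in h).
have [g1 hg1 sg1] := smooth_real_derive (hf _ _ sX sY).
have [g2 hg2 sg2] := smooth_real_derive sg1.
have [M1 M10 hM1] := smooth_real_bounded_itv 0 1 sg1.
have [M2 M20 hM2] := smooth_real_bounded_itv 0 1 sg2.
(* In the variable [z = 1 / r], where the curve is affine near [n], the second derivative is
   [2 z^-3 g1 (1/z) + z^-4 g2 (1/z)]; at [z = n >= 1] it is at most [2 M1 + M2]. *)
pose n := (Num.truncn (M1 *+ 2 + M2)).+1.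
have nM : M1 *+ 2 + M2 < n%:R by exact: truncnS_gt.
have n0 : 0 < n%:R :> R by rewrite ltr0n.
have nn0 : n%:R != 0 :> R by rewrite gt_eqF.
have hausR : hausdorff_space R by exact: norm_hausdorff.
have [_ _ hpn] := hp n.
set xn := (p n).1 in hpn; set yn := (p n).2 in hpn.
set e : R := expR (- n%:R).
have aff z : has_curve_derive (fun z => yn + e * (z - n%:R)) z e.
  have h1 := has_curve_deriveD (has_curve_derive_id z)
    (has_curve_derive_cst (- n%:R : R) z).
  have h2 := has_curve_deriveZ (has_curve_derive_cst e z) h1.
  have := has_curve_deriveD (has_curve_derive_cst yn z) h2.
  by rewrite /GRing.scale/= mul0r !add0r addr0 mulr1.
have psi1 z : has_curve_derive (fun z => f xn (yn + e * (z - n%:R))) z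
    (e * f1 xn (yn + e * (z - n%:R))).
  exact: (has_curve_derive_comp (aff z) (hf1 _ _)).
have psi2 : has_curve_derive (fun z => e * f1 xn (yn + e * (z - n%:R))) n%:R
    (e * (e * f2 xn yn)).
  have h := has_curve_derive_comp (aff n%:R)
    (hf2 xn (yn + e * (n%:R - n%:R))).
  have := has_curve_deriveZ (has_curve_derive_cst e n%:R) h.
  by rewrite /GRing.scale/= mul0r add0r subrr mulr0 addr0.
have inv : (r : R)^-1 @[r --> (n%:R : R)] --> (n%:R^-1 : R).
  by apply: cvgV => //; exact: cvg_id.
have phi : \forall z \near (n%:R : R), f (X z^-1) (Y z^-1) = f xn (yn + e * (z - n%:R)).
  have /inv := XY n (ltn0Sn _); rewrite /= => h; near=> z.
  have [-> ->] : X z^-1 = xn /\ Y z^-1 = yn + e * (z^-1^-1 - n%:R) by near: z.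
  by rewrite invrK.
have dphi : \forall z \near (n%:R : R),
    - (z^-1 * z^-1) * g1 z^-1 = e * f1 xn (yn + e * (z - n%:R)).
  near=> z.
  have z0 : z != 0 by rewrite gt_eqF//; near: z; exact: lt_nbhsr.
  apply: (has_curve_derive_uniq hausR _ (psi1 z)).
  apply: (@has_curve_derive_near _ _ (fun z => f (X z^-1) (Y z^-1))).
    by near: z; exact: nbhs_interior phi.
  exact: (has_curve_derive_comp (has_curve_deriveV z0) (hg1 z^-1)).
have ddphi : has_curve_derive (fun z => - (z^-1 * z^-1) * g1 z^-1) n%:R
   (2 * (n%:R^-1 * n%:R^-1 * n%:R^-1) * g1 n%:R^-1 +
    (n%:R^-1 * n%:R^-1) * (n%:R^-1 * n%:R^-1) * g2 n%:R^-1).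
  have hV := has_curve_deriveV nn0.
  have hVV := has_curve_deriveZ hV hV.
  have hg := has_curve_derive_comp hV (hg2 n%:R^-1).
  have := has_curve_deriveZ (has_curve_deriveZ
    (has_curve_derive_cst (-1 : R) n%:R) hVV) hg.
  rewrite /GRing.scale/= => h.
  have -> : (fun z : R => - (z^-1 * z^-1) * g1 z^-1) =
     (fun z : R => (-1 * (z^-1 * z^-1)) * (g1 \o (fun r : R => r^-1)) z).
    by apply/funext => z; rewrite /= mulN1r.
  by move: h; congr has_curve_derive; rewrite /=; ring.
have E := has_curve_derive_uniq hausR (has_curve_derive_near dphi ddphi) psi2.
have n1 : n%:R^-1 <= 1 :> R by rewrite invf_le1// ler1n.
have nV0 : 0 < n%:R^-1 :> R by rewrite invr_gt0.
have n01 : 0 <= (n%:R^-1 : R) <= 1 by rewrite (ltW nV0).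
have := hM1 _ n01; have := hM2 _ n01; move: E n1 nV0.
set q := n%:R^-1; set G1 := g1 q; set G2 := g2 q => E q1 q0 hG2 hG1.
have q2 : 0 <= q * q <= 1 by rewrite mulr_ge0 ?(ltW q0)//= mulr_ile1// ltW.
have q3 : 0 <= q * q * q <= 1.
  by case/andP: q2 => ? ?; rewrite mulr_ge0 ?(ltW q0)//= mulr_ile1// ltW.
have q4 : 0 <= q * q * (q * q) <= 1.
  by case/andP: q2 => ? ?; rewrite mulr_ge0//= mulr_ile1.
have L : `|e * (e * f2 xn yn)| <= M1 *+ 2 + M2.
  rewrite -E; apply: le_trans (ler_normD _ _) _; apply: lerD.
    case/andP: q3 => q30 q31; rewrite normrM (_ : `|2 * (q * q * q)| = 2 * (q * q * q)).
      rewrite -[leLHS]mulrA -(mulr_natl M1) ler_pM2l//.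
      by apply: le_trans hG1; rewrite ler_piMl.
    by rewrite ger0_norm// mulr_ge0.
  case/andP: q4 => q40 q41; rewrite normrM (ger0_norm q40).
  by apply: le_trans hG2; rewrite ler_piMl.
have e0 : 0 < e by exact: expR_gt0.
have : n%:R < `|e * (e * f2 xn yn)|.
  rewrite !normrM (gtr0_norm e0).
  have ee : e * expR n%:R = 1 by rewrite /e expRN mulVf// gt_eqF// expR_gt0.
  have -> : n%:R = e * (e * (n%:R * expR n%:R * expR n%:R)) :> R.
    transitivity (n%:R * (e * expR n%:R) * (e * expR n%:R) : R); last ring.
    by rewrite ee !mulr1.
  by rewrite !ltr_pM2l.
lra.
Unshelve. all: by end_near. Qed.

End CurveThroughPoints.

(** * A lower bound for the gain of action under a local time shift *)

Section VariationGain.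
Context {R : realType}.
Implicit Types (u v : R -> R) (t s x y : R).

Lemma mean_value u u' (a b : R) : (forall t, has_curve_derive u t (u' t)) ->
  exists2 c, `|c - a| <= `|b - a| & u b - u a = u' c * (b - a).
Proof.
move=> uu'; have cu : continuous u.
  by move=> t; exact: has_curve_derive_continuous (uu' t).
have mv x y : x <= y ->
    exists2 c, x <= c <= y & u y - u x = u' c * (y - x).
  move=> xy; have [||c] := @MVT_segment R u u' x y xy.
  - by move=> z _; apply/has_curve_derive_is_derive.
  - exact: continuous_subspaceT.
  - by rewrite in_itv/= => hc E; exists c.
have [ab|/ltW ab] := leP a b.
- have [c /andP[ac cb] E] := mv _ _ ab; exists c => //.
  by rewrite !ger0_norm ?subr_ge0// lerB.
- have [c /andP[bc ca] E] := mv _ _ ab; exists c.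
    by rewrite !ler0_norm ?subr_le0// lerN2 lerB.
  by rewrite -opprB E -mulrN opprB.
Qed.

(** Two applications of the mean value theorem; the factor [1 / 2] of Taylor's formula is lost,
    which is harmless. *)
Lemma taylor_bound u u' u2 (a b M : R) :
  (forall t, has_curve_derive u t (u' t)) ->
  (forall t, has_curve_derive u' t (u2 t)) ->
  (forall t, `|t - a| <= `|b - a| -> `|u2 t| <= M) ->
  `|u b - u a - u' a * (b - a)| <= M * (b - a) ^+ 2.
Proof.
move=> h1 h2 hM; have [c ca ->] := mean_value a b h1.
have [d da E] := mean_value a c h2.
rewrite -mulrBl E -mulrA normrM.
apply: ler_pM => //; first by apply: hM; exact: le_trans da ca.
by rewrite normrM -real_normK ?num_real// expr2 ler_wpM2r.
Qed.

Section Energy.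
Variables f f1 f2 : R -> R -> R.
Hypothesis smooth_f : forall X Y, smooth_real X -> smooth_real Y ->
  smooth_real (fun r => f (X r) (Y r)).
Hypothesis f_f1 : forall x y, has_curve_derive (f x) y (f1 x y).
Hypothesis f1_f2 : forall x y, has_curve_derive (f1 x) y (f2 x y).

Lemma partial_expansion (x0 : R) : exists d M : R, [/\ 0 < d, 0 <= M &
  forall x y, `|x - x0| <= d -> `|y| <= d ->
    `|f x y - f x 0 - f1 x 0 * y| <= M * y ^+ 2].
Proof.
have [d [M [d0 hM]]] := second_partial_bounded x0 smooth_f f_f1 f1_f2.
exists d, M; split=> // [|x y xd yd].
  have := hM x0 0; rewrite subrr normr0 => h.
  exact: le_trans (h (ltW d0) (ltW d0)).
have := @taylor_bound (f x) (f1 x) (f2 x) 0 y M (@f_f1 x) (@f1_f2 x).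
rewrite !subr0; apply => t; rewrite subr0 => ty.
by apply: hM => //; exact: le_trans yd.
Qed.

(** The difference quotients [(f x y - f x 0) / y] are continuous in [x] and, by the expansion,
    approximate [f1 x 0] within [M |y|], uniformly for [x] near [x0]. *)
Lemma partial_continuous : continuous (fun x => f1 x 0).
Proof.
move=> x0; have [d [M [d0 M0 hM]]] := partial_expansion x0.
apply/cvgrPdist_lt => e e0.
(* A fixed increment with [M * y <= e / 4]: the expansion errors at [x0] and at [x] and the
   variation of the quotient then cost [e / 4] each. *)
pose y := Num.min d (e / (4 * (M + 1))).
have y0 : 0 < y by rewrite lt_min d0/= divr_gt0// mulr_gt0//; lra.
have yd : `|y| <= d by rewrite gtr0_norm// ge_min lexx.
have My : M * y <= e / 4.
  have : y <= e / (4 * (M + 1)) by rewrite ge_min lexx orbT.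
  rewrite ler_pdivlMr; last lra.
  by move=> h; rewrite ler_pdivlMr//; nra.
have cq : continuous (fun x => f x y - f x 0).
  apply: smooth_real_continuous; apply: smooth_realB;
  exact: smooth_f smooth_real_id (smooth_real_cst _).
have ey : 0 < y * (e / 4) by rewrite mulr_gt0// divr_gt0.
have := cq x0; move/cvgrPdist_lt/(_ _ ey) => ne.
near=> x.
have xd : `|x - x0| <= d.
  by rewrite distrC; near: x; apply: cvgr_dist_le => //; exact: cvg_id.
have xe : `|(f x0 y - f x0 0) - (f x y - f x 0)| < y * (e / 4) by near: x.
have h0 := hM x0 y; rewrite subrr normr0 in h0; have {}h0 := h0 (ltW d0) yd.
have h1 := hM x y xd yd.
have My2 : M * y ^+ 2 <= y * (e / 4) 
  by rewrite (_ : M * y ^+ 2 = y * (M * y)) ?ler_pM2l//; ring.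
rewrite -(ltr_pM2l y0) -[X in X * `|_|](gtr0_norm y0) -normrM.
have {h0 h1 xe} : `|y * (f1 x0 0 - f1 x 0)| <
    y * (e / 4) + y * (e / 4) + y * (e / 4).
  have -> : y * (f1 x0 0 - f1 x 0) =
    - (f x0 y - f x0 0 - f1 x0 0 * y) + (f x y - f x 0 - f1 x 0 * y)
     + ((f x0 y - f x0 0) - (f x y - f x 0)) by ring.
  apply: le_lt_trans (ler_normD _ _) _; apply: ler_ltD => //.
  apply: le_trans (ler_normD _ _) _; rewrite normrN.
  by apply: lerD; [exact: le_trans h0 My2|exact: le_trans h1 My2].
move/lt_trans; apply; nra.
Unshelve. all: by end_near. Qed.

(* Shifting time by [s] near [p] only, and back near [q], changes the action by
   at least [s] times the energy drop, up to [O(s ^ 2)]: the bound is an exact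
   derivative [H'], so that no convergence theorem is needed. *)
Lemma variation_gain (p q eps : R) : 0 < eps ->
  f1 q 0 - f q 0 < f1 p 0 - f p 0 ->
  exists phi phi' H H' : R -> R, exists k C s0 : R,
  [/\ smooth_real phi, forall t, has_curve_derive phi t (phi' t) &
      forall t, `|phi t| <= 1] /\
  [/\ smooth_real H, forall t, has_curve_derive H t (H' t), 0 < k & 0 < s0] /\
  [/\ forall t, t <= Num.min p q -> phi t = 0 /\ H t = 0,
      forall t, Num.max p q + eps <= t -> phi t = 0 /\ H t = k &
      forall s t, 0 < s < s0 -> Num.min p q <= t <= Num.max p q + eps ->
        s * H' t - C * s ^+ 2 <= f (t + s * phi t) (s * phi' t) - f t 0].
Proof.
move=> eps0 hpq.
pose g x := f x 0; pose D x := f1 x 0; pose e x := D x - g x.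
have sg : smooth_real g by exact: smooth_f smooth_real_id (smooth_real_cst _).
have [g1 gg1 sg1] := smooth_real_derive sg.
have [g2 gg2 sg2] := smooth_real_derive sg1.
have ce : continuous e.
  move=> x; apply: cvgB; first exact: partial_continuous.
  exact: smooth_real_continuous.
(* The energy gap is cut in three: [e q < m < m + k < e p], so that [e > m + k] near [p] and [e < m]
   near [q]. *)
pose k := (e p - e q) / 3; pose m := e q + k.
have epq : e q < e p by [].
have k0 : 0 < k by rewrite divr_gt0// subr_gt0.
have near_p : \forall x \near p, m + k < e x.
  by move/cvgr_gt: (ce p); apply; rewrite /m /k; lra.
have near_q : \forall x \near q, e x < m.
  by move/cvgr_lt: (ce q); apply; rewrite /m; lra.
have [dp [Mp [dp0 Mp0 hMp]]] := partial_expansion p.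
have [dq [Mq [dq0 Mq0 hMq]]] := partial_expansion q.
have [dp' /= dp'0 hdp] := near_p; have [dq' /= dq'0 hdq] := near_q.
pose d := Num.min (Num.min dp dq) (Num.min (dp' / 2) (dq' / 2)).
have d0 : 0 < d by rewrite !lt_min dp0 dq0 !divr_gt0.
have ddp : d <= dp by rewrite !ge_min lexx.
have ddq : d <= dq by rewrite !ge_min lexx orbT.
have ddp' : d < dp'.
  by apply: (@le_lt_trans _ _ (dp' / 2)); [rewrite !ge_min lexx !orbT|lra].
have ddq' : d < dq'.
  by apply: (@le_lt_trans _ _ (dq' / 2)); [rewrite !ge_min lexx !orbT|lra].
have {hdp} hp x : `|x - p| <= d -> m + k < e x.
  by move=> xd; apply: hdp; rewrite /= distrC (le_lt_trans xd).
have {hdq} hq x : `|x - q| <= d -> e x < m.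
  by move=> xd; apply: hdq; rewrite /= distrC (le_lt_trans xd).
have [S [sS S0 S1 S01 Sm]] := @exists_smooth_step R.
(* Width of the ramps: a time within [d / 2] after [p] or [q], shifted by less than [d / 2], stays
   where the energy estimates hold. *)
pose eta := Num.min eps (d / 2).
have eta0 : 0 < eta by rewrite lt_min eps0 divr_gt0.
have etae : eta <= eps by rewrite ge_min lexx.
have etad : eta <= d / 2 by rewrite ge_min lexx orbT.
pose ramp (r t : R) := S ((t - r) * eta^-1).
have sramp r : smooth_real (ramp r).
  apply: smooth_real_comp sS; apply: smooth_realM (smooth_real_cst _).
  exact: smooth_realB smooth_real_id (smooth_real_cst _).
have ramp0 r t : t <= r -> ramp r t = 0.
  by move=> tr; rewrite /ramp S0// mulr_le0_ge0 ?subr_le0// invr_ge0 ltW.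
have ramp1 r t : r + eta <= t -> ramp r t = 1.
  by move=> tr; rewrite /ramp S1// ler_pdivlMr// mul1r; lra.
have ramp_derive r : exists2 w, smooth_real w &
    (forall t, has_curve_derive (ramp r) t (w t)) /\ forall t, 0 <= w t /\
      (w t != 0 -> r <= t <= r + eta).
  have [w rw sw] := smooth_real_derive (sramp r).
  exists w => //; split=> // t; split.
    apply: homo_has_derive_ge0 (rw t) => x y xy; apply: Sm.
    by rewrite ler_wpM2r ?invr_ge0 ?(ltW eta0)// lerB.
  move=> wt; rewrite !leNgt; apply/andP; split; apply/negP => ht;
    move/eqP: wt; apply.
  - apply: (has_curve_derive_uniq _ (rw t)); first exact: norm_hausdorff.
    apply: has_curve_derive_near (has_curve_derive_cst (0 : R) t).
    near=> y; rewrite ramp0//; near: y; exact: lt_le_nbhsl.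
  - apply: (has_curve_derive_uniq _ (rw t)); first exact: norm_hausdorff.
    apply: has_curve_derive_near (has_curve_derive_cst (1 : R) t).
    near=> y; rewrite ramp1//; near: y; exact: lt_le_nbhsr.
have [P sP [PP hP]] := ramp_derive p; have [Q sQ [QQ hQ]] := ramp_derive q.
pose phi t := ramp p t - ramp q t; pose phi' t := P t - Q t.
(* The first-order rate is [(g phi)' + e phi'] with [phi' = P - Q]. As [P] and [Q] are nonnegative
   and live near [p] and [q], [e phi' >= m phi' + k P]; [H] is the primitive of the resulting lower
   bound. It ends at [k] because [phi] returns to 0 while [ramp p] stays at 1. *)
pose H t := (g t + m) * phi t + k * ramp p t.
pose H' t := g1 t * phi t + (g t + m) * phi' t + k * P t.
have sphi : smooth_real phi by exact: smooth_realB.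
have sphi' : smooth_real phi' by exact: smooth_realB.
have phi_phi' t : has_curve_derive phi t (phi' t).
  have := has_curve_deriveD (PP t)
    (has_curve_deriveZ (has_curve_derive_cst (-1 : R) t) (QQ t)).
  rewrite /GRing.scale/= mul0r add0r mulN1r.
  by rewrite (_ : (fun y => _) = phi)//; apply/funext => y; rewrite mulN1r.
have H_H' t : has_curve_derive H t (H' t).
  have hgm := has_curve_deriveD (gg1 t) (has_curve_derive_cst m t).
  have := has_curve_deriveD (has_curve_deriveZ hgm (phi_phi' t))
    (has_curve_deriveZ (has_curve_derive_cst k t) (PP t)).
  by congr has_curve_derive; rewrite /H' /GRing.scale/=; ring.
have phi1 t : `|phi t| <= 1.
  have := S01 ((t - p) * eta^-1); have := S01 ((t - q) * eta^-1).
  by rewrite ler_norml /phi /ramp => /andP[? ?] /andP[? ?]; apply/andP; split; lra.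
pose lo := Num.min p q; pose hi := Num.max p q + eps.
have [B B0 hB] := smooth_real_bounded_itv lo hi sphi'.
have [G1 G10 hG1] := smooth_real_bounded_itv (lo - 1) (hi + 1) sg1.
have [G2 G20 hG2] := smooth_real_bounded_itv (lo - 1) (hi + 1) sg2.
(* The three bounds keep the shifted time in the interval enlarged by 1, within [d] of the ramp's
   starting point, and the second argument of [f] below [d]; [B + 1] avoids division by zero. *)
pose s0 := Num.min 1 (Num.min (d / 2) (d / (B + 1))).
(* The quadratic errors come from Taylor's formula for [g] along the shift, from replacing [g x] by
   [g t] in front of [phi'], and from the expansion of [f] in its second argument. *)
exists phi, phi', H, H', k, (G2 + G1 * B + (Mp + Mq) * B ^+ 2), s0.
split; first by split.
split.
  split=> //; last by rewrite !lt_min ltr01 !divr_gt0//; lra.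
  apply: smooth_realD; apply: smooth_realM => //; last exact: smooth_real_cst.
  exact: smooth_realD (smooth_real_cst _).
split.
- move=> t; rewrite le_min => /andP[tp tq].
  by rewrite /H /phi !ramp0// subrr !mulr0 addr0.
- move=> t ht; have : Num.max p q <= t - eta.
    by rewrite lerBrDr (le_trans _ ht)// lerD2l.
  rewrite ge_max => /andP[tp tq].
  by rewrite /H /phi !ramp1 -?lerBrDr// subrr mulr0 mulr1 add0r.
move=> s t /andP[s_gt0]; rewrite !lt_min => /and3P[s1 sd sB] /andP[lot thi].
set x := t + s * phi t.
have xt : `|x - t| <= s.
  by rewrite /x addrC addKr normrM gtr0_norm// ler_piMr// ltW.
have xE : x - t = s * phi t by rewrite /x addrC addKr.
have Bt : `|phi' t| <= B by apply: hB; rewrite lot.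
have yd : `|s * phi' t| <= d.
  rewrite normrM gtr0_norm//; rewrite ltr_pdivlMr in sB; last lra.
  by move: (normr_ge0 (phi' t)) Bt sB s_gt0; clear; nra.
have itvt z : `|z - t| <= `|x - t| -> lo - 1 <= z <= hi + 1.
  move=> zt; have : `|z - t| <= 1.
    exact: le_trans zt (le_trans xt (ltW s1)).
  rewrite -/lo in lot; rewrite -/hi in thi.
  rewrite ler_norml => /andP[z1 z2]; apply/andP; split.
    by move: z1 lot; clear; lra.
  by move: z2 thi; clear; lra.
have xp : P t != 0 -> `|x - p| <= d.
  move=> /((hP t).2)/andP[t1 t2]; move: xt; rewrite !ler_norml => /andP[x1 x2].
  by move: x1 x2 t1 t2 sd etad eta0 s_gt0; clear; move=> *; apply/andP; split; lra.
have xq : Q t != 0 -> `|x - q| <= d.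
  move=> /((hQ t).2)/andP[t1 t2]; move: xt; rewrite !ler_norml => /andP[x1 x2].
  by move: x1 x2 t1 t2 sd etad eta0 s_gt0; clear; move=> *; apply/andP; split; lra.
have y2 : (s * phi' t) ^+ 2 <= B ^+ 2 * s ^+ 2.
  rewrite exprMn mulrC ler_wpM2r ?sqr_ge0// -[leLHS]real_normK ?num_real//.
  by rewrite lerXn2r// nnegrE.
have hf : g x + D x * (s * phi' t) - (Mp + Mq) * B ^+ 2 * s ^+ 2 <=
    f x (s * phi' t).
  have hM M : 0 <= M <= Mp + Mq ->
      `|f x (s * phi' t) - f x 0 - f1 x 0 * (s * phi' t)| <=
        M * (s * phi' t) ^+ 2 ->
      g x + D x * (s * phi' t) - (Mp + Mq) * B ^+ 2 * s ^+ 2 <= f x (s * phi' t).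
    move=> /andP[M0 MM]; rewrite ler_norml -/(D x) -/(g x) => /andP[h _].
    have : M * (s * phi' t) ^+ 2 <= (Mp + Mq) * B ^+ 2 * s ^+ 2.
      by rewrite -mulrA ler_pM ?sqr_ge0.
    by move: h; clear; lra.
  (* The expansion is available near [p] and near [q]; where both ramps are stationary, [phi' = 0]
     and the inequality is trivial. *)
  have [P0|P0] := eqVneq (P t) 0; last first.
    apply: (hM Mp); first by rewrite Mp0 lerDl.
    by apply: hMp; [exact: le_trans (xp P0) _|exact: le_trans yd _].
  have [Q0|Q0] := eqVneq (Q t) 0; last first.
    apply: (hM Mq); first by rewrite Mq0 lerDr.
    by apply: hMq; [exact: le_trans (xq Q0) _|exact: le_trans yd _].
  apply: (hM 0); first by rewrite lexx addr_ge0.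
  by rewrite /phi' P0 Q0 subrr mulr0 mulr0 subrr subr0 normr0 mul0r.
have hD : (g x + m) * phi' t + k * P t <= D x * phi' t.
  have hPk : k * P t <= (e x - m) * P t.
    have [->|P0] := eqVneq (P t) 0; first by rewrite !mulr0.
    by rewrite ler_wpM2r ?(hP t).1// lerBrDl; exact: ltW (hp _ (xp P0)).
  have hQk : (e x - m) * Q t <= 0.
    have [->|Q0] := eqVneq (Q t) 0; first by rewrite !mulr0.
    by rewrite mulr_le0_ge0 ?(hQ t).1// subr_le0; exact: ltW (hq _ (xq Q0)).
  have -> : D x * phi' t = (g x + m) * phi' t + (e x - m) * (P t - Q t).
    by rewrite /e /phi'; ring.
  by rewrite lerD2l mulrBr; move: hPk hQk; clear; lra.
have hg : s * phi t * g1 t - G2 * s ^+ 2 <= g x - g t.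
  have := taylor_bound gg1 gg2 (fun z hz => hG2 z (itvt z hz)).
  rewrite ler_norml xE => /andP[h _].
  have : G2 * (s * phi t) ^+ 2 <= G2 * s ^+ 2.
    rewrite ler_wpM2l// exprMn ler_piMr ?sqr_ge0//.
    by rewrite -real_normK ?num_real// expr_le1.
  by move: h; clear; lra.
have hgp : (g t) * phi' t - G1 * B * s <= g x * phi' t.
  have [c ct E] := mean_value t x gg1.
  have : `|(g x - g t) * phi' t| <= G1 * s * B.
    by rewrite E !normrM !ler_pM// ?mulr_ge0// hG1 ?itvt.
  by rewrite ler_norml mulrBl => /andP[h _]; move: h; clear; lra.
rewrite /H'.
have : s * ((g t * phi' t - G1 * B * s) + m * phi' t + k * P t) <=
    D x * (s * phi' t).
  rewrite [leRHS]mulrCA ler_pM2l//; by move: hD hgp; clear; rewrite mulrDl; lra.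
by rewrite -[f t 0]/(g t); move: hf hg; rewrite !expr2; clear; lra.
Unshelve. all: by end_near. Qed.

End Energy.
End VariationGain.

(** * Continuity and integrability of the Lagrangian along curves *)

Section LagrangianAlongCurves.
Context {R : realType} {E : tvsType R}.
Implicit Types (s t r x y : R).

Lemma has_curve_derive_curve_derive (u : R -> E) t (l : E) :
  hausdorff_space E -> has_curve_derive u t l -> curve_derive u t = l.
Proof.
move=> hE ul; apply: (has_curve_derive_uniq hE _ ul).
by apply: (xgetPex 0); exists l.
Qed.

Lemma curve_derive_near (u v : R -> E) t : (\forall y \near t, u y = v y) ->
  curve_derive u t = curve_derive v t.
Proof.
move=> uv; rewrite /curve_derive; congr xget; apply/funext => l.
apply/propext; split; first exact: has_curve_derive_near.
by apply: has_curve_derive_near; apply: filterS uv => y ->.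
Qed.

Lemma near_eq_continuous (T : topologicalType) (u v : R -> T) t :
  (\forall y \near t, u y = v y) -> {for t, continuous u} ->
  {for t, continuous v}.
Proof.
move=> uv cu; rewrite /prop_for /continuous_at -(nbhs_singleton uv).
by apply: cvg_trans cu; exact: near_eq_cvg.
Qed.

(* A smooth map on an interval need not extend to a smooth curve; locally, the
   precomposition with [k] does. *)
Lemma local_smooth_retraction (I : set R) (t0 : R) : open I -> I t0 ->
  exists d (k : R -> R), [/\ 0 < d, smooth_real k, forall t, I (k t),
    forall t, `|t - t0| <= d -> I t & forall t, `|t - t0| <= d -> k t = t].
Proof.
move=> oI It0; have [e /= e0 eI] := oI _ It0.
have e3 : 0 < e / 3 by lra.
have [K [sK K1 K2]] := exists_smooth_clamp e3.
exists (e / 3), (fun t => t0 + K (t - t0)); split=> //.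
- apply: smooth_realD (smooth_real_cst _) _; apply: smooth_real_comp sK.
  exact: smooth_realB smooth_real_id (smooth_real_cst _).
- move=> t; apply: eI; rewrite /= opprD addrA subrr add0r normrN.
  by have := K2 (t - t0); lra.
- by move=> t ht; apply: eI; rewrite /= distrC; lra.
- by move=> t ht; rewrite K1// addrC subrK.
Qed.

Hypothesis hE : hausdorff_space E.

Let hEE : hausdorff_space (E * E)%type := hausdorff_prod hE hE.
Let hR : hausdorff_space R := @norm_hausdorff R R.

Variables (N : set E) (L : E * E -> R).
Hypothesis smooth_L : smooth_map (N `*` [set: E]) [set: R] L.

Lemma smooth_real_lagrangian (u v : R -> E) :
  (forall n, n_differentiable n u) -> (forall n, n_differentiable n v) ->
  (forall t, N (u t)) -> smooth_real (fun t => L (u t, v t)).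
Proof.
move=> su sv Nu; apply/(@smooth_curveP R R _ hR).
have suv : smooth_curve (fun t => (u t, v t)).
  by apply/(smooth_curveP _ hEE) => n; exact: n_differentiable_pair.
have Nuv t : (N `*` [set: E]) (u t, v t) by split=> //; exact: Nu.
exact: smooth_L.2 suv Nuv.
Qed.

Variable I : set R.
Hypothesis open_I : open I.

Lemma smooth_map_curve (w : R -> E) (k : R -> R) : smooth_map I N w ->
  smooth_real k -> (forall t, I (k t)) ->
  forall n, n_differentiable n (w \o k).
Proof.
move=> sw sk Ik; apply/(smooth_curveP _ hE); apply: sw.2 => //.
exact/(@smooth_curveP R R _ hR).
Qed.

(** Smoothness of [L] can only be tested on curves defined on the whole line, so [w] is replaced by
    [w \o k], which has the same germ, hence the same velocity, at each time near [t0]. *)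
Lemma lagrangian_continuous (w : R -> E) : smooth_map I N w ->
  forall t, I t -> {for t, continuous (fun t => L (w t, curve_derive w t))}.
Proof.
move=> sw t0 It0.
have [d [k [d0 sk Ik _ kE]]] := local_smooth_retraction open_I It0.
have swk := smooth_map_curve sw sk Ik.
have [w' ww' sw'] := n_differentiable_derive hE swk.
have near_d : \forall t \near t0, `|t - t0| <= d.
  near=> t; rewrite distrC; near: t; apply: cvgr_dist_le => //; exact: cvg_id.
have kw : \forall t \near t0, (w \o k) t = w t.
  by apply: filterS near_d => t ht; rewrite /= kE.
apply: (@near_eq_continuous _ (fun t => L ((w \o k) t, w' t))).
  near=> t; congr L; congr pair; first by near: t.
  rewrite -(has_curve_derive_curve_derive hE (ww' t)).
  by apply: curve_derive_near; near: t; exact: nbhs_interior kw.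
apply: smooth_real_continuous; apply: smooth_real_lagrangian => // t.
exact: sw.1.
Unshelve. all: by end_near. Qed.

Lemma lagrangian_integrable (w : R -> E) (J : set R) : smooth_map I N w ->
  open J -> compact (closure J) -> closure J `<=` I ->
  (@lebesgue_measure R).-integrable J
    (EFin \o (fun t => L (w t, curve_derive w t))).
Proof.
move=> sw oJ cJ JI.
apply: (@integrableS _ (measurableTypeR R) R lebesgue_measure (closure J) J).
- by apply: measurable_realfun.closed_measurable; exact: closed_closure.
- exact: measurable_realfun.open_measurable.
- exact: subset_closure.
- apply: continuous_compact_integrable => //.
  apply: continuous_in_subspaceT => t /set_mem/JI.
  exact: lagrangian_continuous.
Qed.

(** The integral over [J] reduces to [[a, b]], where the minorant [F'] is integrated by the
    fundamental theorem of calculus. It will be applied to the difference of two Lagrangians, which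
    vanishes off the support of the variation. *)
Lemma Rintegral_ge_increment (J : set R) (u F F' : R -> R) (a b : R) :
  a < b -> open J -> `[a, b] `<=` J ->
  (@lebesgue_measure R).-integrable J (EFin \o u) ->
  (forall t, J t -> ~ `[a, b]%classic t -> u t = 0) ->
  (forall t, has_curve_derive F t (F' t)) -> continuous F' ->
  (forall t, `[a, b]%classic t -> F' t <= u t) ->
  F b - F a <= Rintegral (@lebesgue_measure R) J u.
Proof.
move=> ab oJ abJ iu u0 FF' cF' F'u.
have mJ : measurable J by exact: measurable_realfun.open_measurable.
have mab : measurable (`[a, b]%classic : set R) by exact: measurable_itv.
have iF' : (@lebesgue_measure R).-integrable `[a, b] (EFin \o F').
  apply: continuous_compact_integrable; first exact: segment_compact.
  exact: continuous_subspaceT.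
have FTC : Rintegral (@lebesgue_measure R) `[a, b] F' = F b - F a.
  have cF : continuous F by move=> t; exact: has_curve_derive_continuous (FF' t).
  rewrite /Rintegral (continuous_FTC2 (F := F) ab)//.
  - exact: continuous_subspaceT.
  - split=> [t _||].
    + by have /has_curve_derive_is_derive[] := FF' t.
    + exact: cvg_at_right_filter (cF a).
    + exact: cvg_at_left_filter (cF b).
  - move=> t _; rewrite derive1E.
    by have /has_curve_derive_is_derive/(@derive_val _ _ _ _ _ _ _) := FF' t.
have JE : J = `[a, b] `|` (J `\` `[a, b]) by rewrite setDUK.
rewrite JE Rintegral_setU//; last 3 first.
- exact: measurableD.
- by rewrite -JE.
- by apply/disj_setPS => t [? []].
rewrite [X in _ <= _ + X](_ : _ = 0) ?addr0; last first.
  rewrite (@eq_Rintegral _ _ _ _ _ (cst 0)); last first.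
    by move=> t /set_mem[Jt tab]; exact: u0.
  by rewrite Rintegral_cst ?mul0r//; exact: measurableD.
rewrite -FTC; apply: le_Rintegral => //.
exact: (@integrableS _ (measurableTypeR R) R lebesgue_measure J).
Qed.

End LagrangianAlongCurves.

(** * Constancy of the energy, locally and then on the whole interval *)

Lemma energy_locally_constant (R : realType) (E : tvsType R) (N : set E)
    (L : E * E -> R) (I : set R) (c : R -> E) (t0 : R) :
  hausdorff_space E -> smooth_map (N `*` [set: E]) [set: R] L -> open I ->
  smooth_map I N c -> critical N L I c -> I t0 ->
  exists2 d : R, 0 < d & forall p q, `|p - t0| <= d -> `|q - t0| <= d ->
    energy L (c p) (curve_derive c p) = energy L (c q) (curve_derive c q).
Proof.
move=> hE smooth_L open_I sc cc It0.
have hR : hausdorff_space R := @norm_hausdorff R R.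
have hRR : hausdorff_space (R * R)%type := hausdorff_prod hR hR.
have [d [k [d0 sk Ik dI kE]]] := local_smooth_retraction open_I It0.
have sck := smooth_map_curve hE sc sk Ik.
have [c' cc' sc'] := n_differentiable_derive hE sck.
have kc t : `|t - t0| < d -> \forall y \near t, (c \o k) y = c y.
  move=> td; have : \forall y \near t, `|t0 - y| < d.
    have h : (t0 - y) @[y --> t] --> t0 - t.
      by apply: cvgB; [exact: cvg_cst|exact: cvg_id].
    by rewrite distrC in td; move/cvgr_norm_lt : h; apply.
  by apply: filterS => y yd; rewrite /= kE// distrC ltW.
have c_c' t : `|t - t0| < d -> has_curve_derive c t (c' t).
  by move=> td; exact: has_curve_derive_near (kc t td) (cc' t).
have c'E t : `|t - t0| < d -> curve_derive c t = c' t.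
  by move=> td; exact: has_curve_derive_curve_derive (c_c' t td).
(* Under a reparametrization [t + s phi t] the Lagrangian along [c] becomes
   [f (t + s phi t) (s phi' t)]. *)
pose f x y := L ((c \o k) x, (1 + y) *: c' x).
have smooth_f X Y : smooth_real X -> smooth_real Y ->
    smooth_real (fun r => f (X r) (Y r)).
  move=> sX sY; apply: (smooth_real_lagrangian hE smooth_L
    (u := (c \o k) \o X) (v := fun r => (1 + Y r) *: c' (X r))).
  - by move=> n; exact: n_differentiable_comp.
  - move=> n; apply: n_differentiableZ.
      exact: smooth_realD (smooth_real_cst 1) sY n.
    exact: (@n_differentiable_comp _ _ n X c').
  - by move=> t; exact: sc.1.
have /choice[f1 hf1] : forall x, exists v : R -> R,
    (forall y, has_curve_derive (f x) y (v y)) /\ smooth_real v.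
  move=> x.
  have [v] := smooth_real_derive (smooth_f _ _ (smooth_real_cst x) smooth_real_id).
  by exists v.
have /choice[f2 hf2] : forall x, exists v : R -> R,
    forall y, has_curve_derive (f1 x) y (v y).
  by move=> x; have [v ? _] := smooth_real_derive (hf1 x).2; exists v.
have energyE t : `|t - t0| < d ->
    energy L (c t) (curve_derive c t) = f1 t 0 - f t 0.
  move=> td; rewrite /energy /partial2 c'E//; congr (_ - _); last first.
    by rewrite /f /= addr0 scale1r kE ?ltW.
  rewrite (_ : (fun s => _) = f t); last first.
    by apply/funext => s; rewrite /f /= kE ?ltW// scalerDl scale1r.
  rewrite derive1E.
  by have /has_curve_derive_is_derive/(@derive_val _ _ _ _ _ _ _) := (hf1 t).1 0.
(* The support of [phi] then lies within [d / 2] of [t0], and the clamped shift below adds at most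
   [d / 4], so perturbed times stay within [d], where [c \o k] is [c]. *)
have d4 : 0 < d / 4 by rewrite divr_gt0.
suff main p q : `|p - t0| <= d / 4 -> `|q - t0| <= d / 4 ->
    f1 p 0 - f p 0 <= f1 q 0 - f q 0.
  exists (d / 4) => // p q hp hq; rewrite !energyE; try lra.
  by apply/eqP; rewrite eq_le !main.
move=> hp hq; rewrite leNgt; apply/negP => hpq.
have [phi [phi' [H [H' [gain [C [s0]]]]]]] := variation_gain smooth_f
  (fun x y => (hf1 x).1 y) hf2 d4 hpq.
set lo := Num.min p q; set hi := Num.max p q + d / 4.
move=> [[sphi phi_phi' phi1] [[sH HH' gain0 s00] [philo phihi hgain]]].
have lod : - (d / 4) <= lo - t0.
  rewrite lerBrDr le_min -!lerBrDr; move: hp hq.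
  by rewrite !ler_norml => /andP[-> _] /andP[-> _].
have hid : hi - t0 <= d / 2.
  have : Num.max p q <= d / 4 + t0.
    rewrite ge_max -!lerBlDr; move: hp hq.
    by rewrite !ler_norml => /andP[_ ->] /andP[_ ->].
  by rewrite /hi; lra.
have lohi : lo < hi.
  by rewrite /lo /hi; apply: (@le_lt_trans _ _ p);
    rewrite ?ge_min ?lexx// -[ltLHS]addr0 ler_ltD// le_max lexx.
have inK t : lo <= t <= hi -> `|t - t0| <= d / 2.
  by move=> /andP[? ?]; rewrite ler_norml; apply/andP; split; lra.
have d8 : 0 < d / 8 by rewrite divr_gt0.
(* The parameter of the variation is clamped, so that the perturbed time stays
   in [I]. *)
have [K [sK K1 K2]] := exists_smooth_clamp d8.
have inI s t : lo <= t <= hi -> `|t + K s * phi t - t0| < d.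
  move=> /inK td; have Kphi : `|K s * phi t| <= 2 * (d / 8).
    by rewrite normrM -[leRHS]mulr1 ler_pM.
  rewrite addrAC; apply: le_lt_trans (ler_normD _ _) _.
  by move: td Kphi d0; clear; lra.
have phi0 t : ~ (lo <= t <= hi) -> phi t = 0.
  move=> /negP; rewrite negb_and -!ltNge => /orP[|] /ltW ht.
    by case: (philo _ ht).
  by case: (phihi _ ht).
have inI' s t : I t -> I (t + K s * phi t).
  move=> It; have [tK|/phi0 ->] := pselect (lo <= t <= hi).
    by apply: dI; exact: ltW (inI s t tK).
  by rewrite mulr0 addr0.
pose v (z : R * R) : E := c (z.2 + K z.1 * phi z.2).
have K0 : K 0 = 0 by rewrite K1// normr0 ltW.
have vv : compact_variation N I c `[lo, hi] v.
  split.
  - split=> [[s t] [_ /= It]|w sw wI]; first by apply: sc.1; exact: inI'.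
    apply: (sc.2 (fun r => (w r).2 + K (w r).1 * phi (w r).2)).
      move/(smooth_curveP _ hRR) : sw => sw; apply/(@smooth_curveP R R _ hR).
      have sw1 : smooth_real (fun r => (w r).1).
        by move=> n; exact: (@n_differentiable_fst R R R n w).
      have sw2 : smooth_real (fun r => (w r).2).
        by move=> n; exact: (@n_differentiable_snd R R R n w).
      by apply: smooth_realD => //; apply: smooth_realM;
        [exact: smooth_real_comp sw1 sK|exact: smooth_real_comp sw2 sphi].
    by move=> r; apply: inI'; case: (wI r).
  - by move=> t _; rewrite /v /= K0 mul0r addr0.
  - exact: segment_compact.
  - move=> t; rewrite /= in_itv/= => /inK td; apply: dI.
    by move: td d0; clear; lra.
  - move=> s t _; rewrite /= in_itv/= => /phi0 tK.
    by rewrite /v /= tK mulr0 addr0.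
have [J [oJ cJ JI KJ dA]] := cc _ _ vv.
have svs s : smooth_map I N (fun t => v (s, t)).
  have [[vN vs] _ _ _ _] := vv; split=> [t It|w sw wI]; first exact: vN.
  apply: (vs (fun r => (s, w r))) => [|r]; last by split=> //; exact: wI.
  apply/(smooth_curveP _ hRR) => n; apply: n_differentiable_pair.
    exact: (@n_differentiable_cst R R n s).
  by move: n; exact/(@smooth_curveP R R _ hR).
pose G s t := L (v (s, t), curve_derive (fun t => v (s, t)) t).
have GK s t : `|s| <= d / 8 -> lo <= t <= hi ->
    G s t = f (t + s * phi t) (s * phi' t).
  move=> sd tK; have := inI s t tK; rewrite (K1 _ sd) => xd.
  rewrite /G /f /v /= (K1 _ sd) kE ?(ltW xd)//; congr (L (_, _)).
  apply: has_curve_derive_curve_derive => //.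
  apply: (@has_curve_derive_comp _ _ c (fun t => t + s * phi t)).
    have := has_curve_deriveD (has_curve_derive_id t)
      (has_curve_deriveZ (has_curve_derive_cst s t) (phi_phi' t)).
    by rewrite /GRing.scale/= mul0r add0r.
  exact: c_c'.
(* The complement of the segment is open, so the variation coincides with [c] around [t] and the
   velocities agree as well. *)
have GnK s t : ~ (lo <= t <= hi) -> G s t = G 0 t.
  move=> tK; have near0 r : \forall y \near t, v (r, y) = c y.
    have : \forall y \near t, ~ (lo <= y <= hi).
      move/negP : tK; rewrite negb_and -!ltNge => /orP[|] ht.
        near=> y; apply/negP; rewrite negb_and -!ltNge; apply/orP; left.
        by near: y; exact: lt_nbhsl.
      near=> y; apply/negP; rewrite negb_and -!ltNge; apply/orP; right.
      by near: y; exact: lt_nbhsr.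
    by apply: filterS => y /phi0 yK; rewrite /v /= yK mulr0 addr0.
  rewrite /G (nbhs_singleton (near0 s)) (nbhs_singleton (near0 0)).
  by rewrite (curve_derive_near (near0 s)) (curve_derive_near (near0 0)).
have iG s : (@lebesgue_measure R).-integrable J (EFin \o G s).
  exact: (lagrangian_integrable hE smooth_L open_I (svs s) oJ cJ JI).
have Again s : 0 < s < Num.min s0 (d / 8) ->
    s * gain - `|C| * s ^+ 2 * (hi - lo) <=
    action L J (fun t => v (s, t)) - action L J (fun t => v (0, t)).
  move=> /andP[s_gt0]; rewrite lt_min => /andP[ss0 sd].
  have -> : action L J (fun t => v (s, t)) - action L J (fun t => v (0, t)) =
      Rintegral (@lebesgue_measure R) J (fun t => G s t - G 0 t).
    by rewrite RintegralB//; exact: measurable_realfun.open_measurable.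
  (* Primitive of the pointwise lower bound; [|C|] replaces [C], whose sign is unknown. *)
  pose F t := s * H t - `|C| * s ^+ 2 * t.
  have FE : F hi - F lo = s * gain - `|C| * s ^+ 2 * (hi - lo).
    have [_ Hlo] := philo _ (lexx lo); have [_ Hhi] := phihi _ (lexx hi).
    by rewrite /F Hlo Hhi; ring.
  have [h' HH2 sh'] := smooth_real_derive sH.
  rewrite -FE; apply: (@Rintegral_ge_increment R J _ F
    (fun t => s * H' t - `|C| * s ^+ 2)) => //.
  - exact: (@integrableB _ (measurableTypeR R) R lebesgue_measure J
      (measurable_realfun.open_measurable oJ) _ _ (iG s) (iG 0)).
  - by move=> t _; rewrite /= in_itv/= => /(GnK s) ->; rewrite subrr.
  - move=> t; have := has_curve_deriveD
      (has_curve_deriveZ (has_curve_derive_cst s t) (HH' t))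
      (has_curve_deriveZ (has_curve_derive_cst (- (`|C| * s ^+ 2)) t)
         (has_curve_derive_id t)).
    rewrite /GRing.scale/= !mul0r !add0r mulr1.
    by rewrite (_ : (fun y => _) = F)//; apply/funext => y; rewrite /F mulNr.
  - have -> : H' = h'.
      by apply/funext => t; exact: has_curve_derive_uniq (HH' t) (HH2 t).
    apply: smooth_real_continuous; apply: smooth_realB (smooth_real_cst _).
    exact: smooth_realM (smooth_real_cst _) sh'.
  - move=> t; rewrite /= in_itv/= => tK.
    have -> : G 0 t = f t 0 by rewrite GK ?normr0 ?(ltW d8)// !mul0r addr0.
    have -> : G s t = f (t + s * phi t) (s * phi' t).
      by rewrite GK// gtr0_norm// ltW.
    apply: le_trans (hgain s t _ tK); last by rewrite s_gt0.
    by rewrite lerB// ler_wpM2r ?sqr_ge0// ler_norm.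
have {dA} /has_curve_derive_is_derive dA := dA.
move/cvgrPdist_lt : dA => /(_ (gain / 2)); rewrite divr_gt0// => /(_ isT).
move=> [r /= r0 hr].
pose M := `|C| * (hi - lo).
have M0 : 0 <= M by rewrite mulr_ge0// subr_ge0 ltW.
(* Criticality makes the action grow by less than [s * gain / 2] for [0 < s < r], while
   [s * M <= gain / 2] forces a growth of at least [s * gain / 2]. *)
pose s := Num.min (Num.min (s0 / 2) (d / 16)) (Num.min (r / 2) (gain / (2 * (M + 1)))).
have s_gt0 : 0 < s by rewrite !lt_min !divr_gt0//; move: M0; clear; lra.
have ss0 : s <= s0 / 2 by rewrite !ge_min lexx.
have sd : s <= d / 16 by rewrite !ge_min lexx !orbT.
have sr : s <= r / 2 by rewrite !ge_min lexx !orbT.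
have sM : s <= gain / (2 * (M + 1)) by rewrite !ge_min lexx !orbT.
have sM' : s * M <= gain / 2.
  rewrite ler_pdivlMr in sM; last by move: M0; clear; lra.
  by move: sM s_gt0; clear; lra.
have := hr s; rewrite /= !sub0r !normrN gtr0_norm// => {}hr.
have := hr _ (lt0r_neq0 s_gt0); rewrite /curve_quotient addr0 ltr_norml.
have sr' : s < r by move: sr r0; clear; lra.
move=> /(_ sr')/andP[_]; rewrite /GRing.scale/= mulrC ltr_pdivrMr// => h.
have := Again s; rewrite s_gt0 lt_min => /(_ _)/le_lt_trans/(_ h).
have -> : (s < s0) && (s < d / 8).
  by apply/andP; split; [move: ss0 s00|move: sd d0]; clear; lra.
move=> /(_ isT); apply/negP; rewrite -leNgt.
have -> : `|C| * s ^+ 2 * (hi - lo) = s * (s * M) by rewrite /M; ring.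
have : s * (s * M) <= s * (gain / 2) by rewrite ler_pM2l.
by clear; lra.
Unshelve. all: by end_near. Qed.

(** A locally constant function has zero derivative, and the mean value theorem applies between any
    two points of the interval. *)
Lemma locally_constant_interval (R : realType) (I : set R) (e : R -> R) :
  is_interval I ->
  (forall t, I t -> exists2 d : R, 0 < d &
    forall p q, `|p - t| <= d -> `|q - t| <= d -> e p = e q) ->
  exists a : R, forall t, I t -> e t = a.
Proof.
move=> hI he.
have de t : I t -> has_curve_derive e t 0.
  move=> /he[d d0 ed].
  apply: has_curve_derive_near (has_curve_derive_cst (e t) t).
  near=> y; apply: ed; first by rewrite subrr normr0 ltW.
  by rewrite distrC; near: y; apply: cvgr_dist_le => //; exact: cvg_id.
have key a b : I a -> I b -> a <= b -> e b = e a.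
  move=> Ia Ib ab; have Iab x : a <= x <= b -> I x by exact: (hI _ _ Ia Ib).
  have [||c _] := @MVT_segment R e (fun=> 0) a b ab.
  - move=> x xab; apply/has_curve_derive_is_derive/de/Iab.
    by move: xab; rewrite in_itv/= => /andP[/ltW -> /ltW ->].
  - apply: continuous_in_subspaceT => x /set_mem/=; rewrite in_itv/= => /Iab Ix.
    exact: has_curve_derive_continuous (de _ Ix).
  - by rewrite mul0r => /eqP; rewrite subr_eq0 => /eqP.
have [[a Ia]|nI] := pselect (exists a, I a); last first.
  by exists 0 => t It; case: nI; exists t.
exists (e a) => t It; have [at_|/ltW ta] := leP a t; first exact: key.
by rewrite (key t a).
Unshelve. all: by end_near. Qed.


Theorem theorem3p14 (R : realType) (E : tvsType R) (hE : frechet_space E)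
    (N : set E) (hN : open N)
    (L : E * E -> R) (hL : smooth_map (N `*` [set: E]) [set: R] L)
    (I : set R) (hIo : open I) (hI : is_interval I)
    (c : R -> E) (hc : smooth_map I N c) (hcrit : critical N L I c) :
  exists e : R, forall t, I t -> energy L (c t) (curve_derive c t) = e.
Proof.
apply: locally_constant_interval hI _ => t It.
exact: energy_locally_constant (frechet_hausdorff hE) hL hIo hc hcrit It.
Qed.
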